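(* Let $f\in C^2([0,\infty))$, and let $g\in C^1(-1,1)\cap C[-1,1]$ satisfy $g(-x)=g(x)$ for $x\in(0,1)$, $g(0)>0$, and $xg'(x)\ge 0$ for $x\in(-1,1)$. For parameters $\lambda>0$, $\mu>0$ consider curves of positive solutions of $$u''+\lambda f(u)-\mu g(x)=0,\quad -1<x<1,\qquad u(-1)=u(1)=0 .$$ (i) Assume that $f$ is concave. Then only turns to the right are possible in the $(\lambda,u(0))$ plane when solutions are continued in $\lambda$ (with $\mu$ fixed), and only turns to the left are possible in the $(\mu,u(0))$ plane when solutions are continued in $\mu$ (with $\lambda$ fixed). (ii) Assume that $f$ is convex. Then only turns to the left are possible in the $(\lambda,u(0))$ plane when solutions are continued in $\lambda$ (with $\mu$ fixed), and only turns to the right are possible in the $(\mu,u(0))$ plane when solutions are continued in $\mu$ (with $\lambda$ fixed).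
   Context: A positive solution is a function $u\in C^2(-1,1)\cap C^1[-1,1]$ satisfying the equation and the boundary conditions with $u>0$ on $(-1,1)$. Solution curves are considered as long as $u'(1)<0$. With $\mu$ fixed, a solution curve in $\lambda$ is a regular $C^1$ curve $s\mapsto(\lambda(s),u(\cdot,s))\in\mathbb{R}\times C^2[-1,1]$ (nonvanishing tangent) consisting of positive solutions with $u'(1)<0$. It turns at $s_0$ if $\lambda(s)$ has a strict local extremum at $s_0$. The turn is to the right if $\lambda(s)>\lambda(s_0)$ for all $s\ne s_0$ near $s_0$, and to the left if $\lambda(s)<\lambda(s_0)$ for all $s\neq s_0$ near $s_0$. Solution curves in $\mu$ (with $\lambda$ fixed), $s\mapsto(\mu(s),u(\cdot,s))$, and their turns are defined in the same way with $\mu(s)$ in place of $\lambda(s)$. *)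

(* Defs.v *)
From Stdlib Require Import Reals Lra FunctionalExtensionality ProofIrrelevance.
From Coquelicot Require Import Coquelicot.
Open Scope R_scope.

(* [is_derive] with [locally x] restricted to [D]: the usual derivative at
   interior points of [D], the one-sided derivative at end points. *)
Definition is_derive_on (D : R -> Prop) (f : R -> R) (x l : R) : Prop :=
  filterdiff f (within D (locally x)) (fun h => scal h l).

Definition derive_on (D : R -> Prop) (f : R -> R) (x : R) : R :=
  iota (is_derive_on D f x).

Fixpoint Ck_on (k : nat) (D : R -> Prop) (f : R -> R) : Prop :=
  match k with
  | O => continuous_on D f
  | S k => (forall x, D x -> exists l, is_derive_on D f x l)
           /\ Ck_on k D (derive_on D f)
  end.

Definition ooint (x : R) : Prop := -1 < x < 1.
Definition ccint (x : R) : Prop := -1 <= x <= 1.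
Definition halfline (x : R) : Prop := 0 <= x.

Definition concave_on (D : R -> Prop) (f : R -> R) : Prop :=
  forall x y t, D x -> D y -> 0 <= t <= 1 ->
    t * f x + (1 - t) * f y <= f (t * x + (1 - t) * y).

Definition convex_on (D : R -> Prop) (f : R -> R) : Prop :=
  forall x y t, D x -> D y -> 0 <= t <= 1 ->
    f (t * x + (1 - t) * y) <= t * f x + (1 - t) * f y.

Definition dense_in_itself (D : R -> Prop) : Prop :=
  forall x (e : posreal), D x -> exists y, D y /\ y <> x /\ Rabs (y - x) < e.

Lemma dense_ccint : dense_in_itself ccint.
Proof.
intros x e Hx; unfold ccint in *.
assert (He := cond_pos e).
assert (H1 := Rmin_l (e / 2) 1); assert (H2 := Rmin_r (e / 2) 1).
assert (H3 : 0 < Rmin (e / 2) 1) by (apply Rmin_pos; lra).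
destruct (Rle_dec x 0).
- exists (x + Rmin (e / 2) 1); repeat split; try lra.
  rewrite Rabs_pos_eq; lra.
- exists (x - Rmin (e / 2) 1); repeat split; try lra.
  rewrite Rabs_left; lra.
Qed.

Lemma within_lim (D : R -> Prop) x : is_filter_lim (within D (locally x)) x.
Proof. intros P HP; unfold within; revert HP; apply filter_imp; auto. Qed.

Lemma is_derive_on_unique (D : R -> Prop) f x l1 l2 :
  dense_in_itself D -> D x ->
  is_derive_on D f x l1 -> is_derive_on D f x l2 -> l1 = l2.
Proof.
intros HD Hx [_ H1] [_ H2].
specialize (H1 x (within_lim D x)); specialize (H2 x (within_lim D x)).
destruct (Req_dec l1 l2) as [|Hne]; [assumption|exfalso].
assert (Hp : 0 < Rabs (l1 - l2) / 4).
{ assert (0 < Rabs (l1 - l2)) by (apply Rabs_pos_lt; lra). lra. }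
destruct (filter_and _ _ (H1 (mkposreal _ Hp)) (H2 (mkposreal _ Hp))) as [d Hd].
destruct (HD x d Hx) as [y [Dy [Hy Hyd]]].
destruct (Hd y Hyd Dy) as [Ha Hb]; clear Hd H1 H2.
simpl in Ha, Hb.
unfold norm, minus, plus, opp, scal in Ha, Hb; simpl in Ha, Hb.
unfold abs, mult in Ha, Hb; simpl in Ha, Hb.
set (c := Rabs (l1 - l2) / 4) in *.
set (dy := y + - x) in *.
set (df := f y + - f x) in *.
assert (Hy0 : 0 < Rabs dy) by (apply Rabs_pos_lt; unfold dy; lra).
assert (Hm : Rabs (dy * (l1 - l2)) <= 2 * (c * Rabs dy)).
{ replace (dy * (l1 - l2)) with ((df + - (dy * l2)) - (df + - (dy * l1))) by ring.
  eapply Rle_trans; [apply Rabs_triang|]; rewrite Rabs_Ropp; lra. }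
rewrite Rabs_mult in Hm.
replace (Rabs (l1 - l2)) with (4 * c) in Hm by (unfold c; field).
assert (0 < c * Rabs dy) by (apply Rmult_lt_0_compat; assumption).
lra.
Qed.

Lemma derive_on_unique (D : R -> Prop) f x l :
  dense_in_itself D -> D x -> is_derive_on D f x l -> derive_on D f x = l.
Proof.
intros HD Hx Hl; unfold derive_on.
apply (iota_unique (V := R_CompleteNormedModule)); [|exact Hl].
intros y Hy; exact (is_derive_on_unique D f x y l HD Hx Hy Hl).
Qed.

Lemma derive_on_correct (D : R -> Prop) f x :
  dense_in_itself D -> D x -> (exists l, is_derive_on D f x l) ->
  is_derive_on D f x (derive_on D f x).
Proof.
intros HD Hx [l Hl]; rewrite (derive_on_unique D f x l); assumption.
Qed.

Lemma within_proper (D : R -> Prop) x : D x -> ProperFilter (within D (locally x)).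
Proof.
intros Hx; split; [|apply within_filter; apply locally_filter].
intros P [d Hd]; exists x; apply Hd; [apply ball_center|exact Hx].
Qed.

Lemma is_derive_on_ext (D : R -> Prop) f g x l :
  (forall y, D y -> f y = g y) -> D x ->
  is_derive_on D f x l -> is_derive_on D g x l.
Proof.
intros Hfg Hx; unfold is_derive_on.
assert (PF := within_proper D x Hx).
apply filterdiff_ext_loc.
- unfold within; apply filter_forall; exact Hfg.
- intros z Hz; rewrite <- (is_filter_lim_unique _ _ (within_lim D x) Hz); auto.
Qed.

Lemma derive_on_ext (D : R -> Prop) f g x :
  dense_in_itself D -> (forall y, D y -> f y = g y) -> D x ->
  (exists l, is_derive_on D f x l) -> derive_on D f x = derive_on D g x.
Proof.
intros HD Hfg Hx [l Hl].
rewrite (derive_on_unique D f x l), (derive_on_unique D g x l); auto.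
exact (is_derive_on_ext D f g x l Hfg Hx Hl).
Qed.

Lemma Ck_on_ext (D : R -> Prop) k : dense_in_itself D ->
  forall f g, (forall y, D y -> f y = g y) -> Ck_on k D f -> Ck_on k D g.
Proof.
intros HD; induction k as [|k IH]; intros f g Hfg; simpl.
- apply continuous_on_ext; exact Hfg.
- intros [H1 H2]; split.
  + intros x Hx; destruct (H1 x Hx) as [l Hl]; exists l.
    exact (is_derive_on_ext D f g x l Hfg Hx Hl).
  + revert H2; apply IH; intros y Hy; apply derive_on_ext; auto.
Qed.

Lemma is_derive_on_lin (D : R -> Prop) a b f g x lf lg :
  is_derive_on D f x lf -> is_derive_on D g x lg ->
  is_derive_on D (fun y => a * f y + b * g y) x (a * lf + b * lg).
Proof.
intros Hf Hg; unfold is_derive_on in *.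
assert (Hc : forall n m : R_AbsRing, mult n m = mult m n) by (intros; apply Rmult_comm).
apply (filterdiff_ext_lin (U := R_NormedModule) (V := R_NormedModule) _
         (fun h : R => plus (scal a (scal h lf)) (scal b (scal h lg)))).
- apply (filterdiff_plus_fct (V := R_NormedModule)
           (fun y => scal a (f y)) (fun y => scal b (g y))).
  + apply (filterdiff_scal_r_fct (V := R_NormedModule) a f); [exact Hc|exact Hf].
  + apply (filterdiff_scal_r_fct (V := R_NormedModule) b g); [exact Hc|exact Hg].
- intros y; unfold plus, scal; simpl; unfold mult; simpl; ring.
Qed.

Lemma derive_on_lin (D : R -> Prop) a b f g x :
  dense_in_itself D -> D x ->
  (exists l, is_derive_on D f x l) -> (exists l, is_derive_on D g x l) ->
  derive_on D (fun y => a * f y + b * g y) x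
  = a * derive_on D f x + b * derive_on D g x.
Proof.
intros HD Hx Hf Hg; apply derive_on_unique; auto.
apply is_derive_on_lin; apply derive_on_correct; auto.
Qed.

Lemma Ck_on_lin (D : R -> Prop) k a b : dense_in_itself D ->
  forall f g, Ck_on k D f -> Ck_on k D g -> Ck_on k D (fun y => a * f y + b * g y).
Proof.
intros HD; induction k as [|k IH]; simpl; intros f g Hf Hg.
- intros x Hx.
  apply (filterlim_comp_2 (G := locally (a * f x)) (H := locally (b * g x))
           (fun y => a * f y) (fun y => b * g y) Rplus).
  + eapply filterlim_comp; [apply Hf, Hx|].
    apply (filterlim_scal_r (V := R_NormedModule) a (f x)).
  + eapply filterlim_comp; [apply Hg, Hx|].
    apply (filterlim_scal_r (V := R_NormedModule) b (g x)).
  + apply (filterlim_plus (V := R_NormedModule) (a * f x) (b * g x)).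
- destruct Hf as [Hf1 Hf2], Hg as [Hg1 Hg2]; split.
  + intros x Hx; destruct (Hf1 x Hx) as [lf Hlf], (Hg1 x Hx) as [lg Hlg].
    exists (a * lf + b * lg); apply is_derive_on_lin; assumption.
  + apply (Ck_on_ext D k HD (fun y => a * derive_on D f y + b * derive_on D g y)).
    * intros y Hy; symmetry; apply derive_on_lin; auto.
    * apply IH; assumption.
Qed.

Lemma is_derive_on_0 (D : R -> Prop) x : is_derive_on D (fun _ => 0) x 0.
Proof.
unfold is_derive_on.
apply (filterdiff_ext_lin (U := R_NormedModule) (V := R_NormedModule) _ (fun _ => zero)).
- apply (filterdiff_const (V := R_NormedModule) 0).
- intros y; unfold scal; simpl; unfold mult, zero; simpl; ring.
Qed.

Lemma Ck_on_0 (D : R -> Prop) k : dense_in_itself D -> Ck_on k D (fun _ => 0).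
Proof.
intros HD; induction k as [|k IH]; simpl.
- intros x _; apply filterlim_const.
- split; [intros x _; exists 0; apply is_derive_on_0|].
  revert IH; apply Ck_on_ext; [exact HD|].
  intros y Hy; symmetry; apply derive_on_unique; auto; apply is_derive_on_0.
Qed.

Lemma Ck_on_continuous (D : R -> Prop) k :
  dense_in_itself D -> forall f : R -> R, Ck_on k D f -> continuous_on D f.
Proof.
intros HD f Hk; destruct k as [|k]; [exact Hk|].
destruct Hk as [H _]; intros x Hx.
assert (PF := within_proper D x Hx).
destruct (H x Hx) as [l Hl].
apply (filterdiff_continuous_aux (V := R_NormedModule) f); [|apply within_lim].
eexists; exact Hl.
Qed.

Definition sup_on (D : R -> Prop) (f : R -> R) : R :=
  real (Lub_Rbar (fun y => exists x, D x /\ y = f x)).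

Definition clamp (x : R) : R := Rmax (-1) (Rmin x 1).

Lemma clamp_in x : ccint (clamp x).
Proof.
unfold ccint, clamp; split; [apply Rmax_l|].
apply Rmax_lub; [lra|apply Rmin_r].
Qed.

Lemma clamp_id x : ccint x -> clamp x = x.
Proof.
unfold ccint, clamp; intros Hx.
rewrite Rmin_left by lra; apply Rmax_right; lra.
Qed.

Lemma clamp_lip x y : Rabs (clamp y - clamp x) <= Rabs (y - x).
Proof.
unfold clamp, Rmax, Rmin.
repeat destruct Rle_dec; unfold Rabs; repeat destruct Rcase_abs; lra.
Qed.

Lemma sup_abs_attained f : continuous_on ccint f ->
  exists M, ccint M /\ sup_on ccint (fun x => Rabs (f x)) = Rabs (f M)
            /\ forall x, ccint x -> Rabs (f x) <= Rabs (f M).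
Proof.
intros Hf.
destruct (continuity_ab_maj (fun x => Rabs (f (clamp x))) (-1) 1) as [M [HM1 HM2]].
- lra.
- intros c Hc; apply continuity_pt_filterlim.
  apply (filterlim_comp _ _ _ (fun x => f (clamp x)) Rabs _ (locally (f (clamp c)))).
  + apply (filterlim_comp _ _ _ clamp f _ (within ccint (locally (clamp c)))).
    * intros P [d Hd]; exists d; intros y Hy; apply Hd; [|apply clamp_in].
      eapply Rle_lt_trans; [apply clamp_lip|exact Hy].
    * apply Hf, clamp_in.
  + apply (continuous_Rabs (f (clamp c))).
- exists M; rewrite clamp_id in HM1 by exact HM2.
  assert (HM : forall x, ccint x -> Rabs (f x) <= Rabs (f M)).
  { intros x Hx; generalize (HM1 x Hx); rewrite clamp_id by exact Hx; auto. }
  split; [exact HM2|split; [|exact HM]].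
  unfold sup_on; rewrite (is_lub_Rbar_unique _ (Rabs (f M))); [reflexivity|].
  split.
  + intros y [x [Hx ->]]; exact (HM x Hx).
  + intros b Hb; apply Hb; exists M; auto.
Qed.

Lemma sup_abs_ub f x : continuous_on ccint f -> ccint x ->
  Rabs (f x) <= sup_on ccint (fun y => Rabs (f y)).
Proof.
intros Hf Hx; destruct (sup_abs_attained f Hf) as [M [_ [-> H]]]; auto.
Qed.

Lemma sup_abs_lub f c : continuous_on ccint f ->
  (forall x, ccint x -> Rabs (f x) <= c) -> sup_on ccint (fun y => Rabs (f y)) <= c.
Proof.
intros Hf Hc; destruct (sup_abs_attained f Hf) as [M [HM [-> _]]]; auto.
Qed.

(* Functions are normalised to vanish off [-1,1], so that Leibniz equality is
   equality on [-1,1]. *)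
Record C2 : Type := mkC2 {
  C2_fun :> R -> R;
  C2_reg : Ck_on 2 ccint C2_fun;
  C2_off : forall x, ~ ccint x -> C2_fun x = 0 }.

Lemma C2_eq (u v : C2) : (forall x, u x = v x) -> u = v.
Proof.
destruct u as [u Hu Hu'], v as [v Hv Hv']; simpl; intros H.
apply functional_extensionality in H; subst v.
f_equal; apply proof_irrelevance.
Qed.

Definition C2_lin (a b : R) (u v : C2) : C2.
Proof.
refine (mkC2 (fun x => a * u x + b * v x) _ _).
- apply Ck_on_lin; [apply dense_ccint|apply C2_reg|apply C2_reg].
- intros x Hx; rewrite !C2_off by exact Hx; ring.
Defined.

Definition C2_zero : C2 :=
  mkC2 (fun _ => 0) (Ck_on_0 ccint 2 dense_ccint) (fun _ _ => eq_refl).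
Definition C2_plus (u v : C2) : C2 := C2_lin 1 1 u v.
Definition C2_opp (u : C2) : C2 := C2_lin (-1) 0 u u.
Definition C2_scal (a : R) (u : C2) : C2 := C2_lin a 0 u u.

Definition C2_norm (u : C2) : R :=
  sup_on ccint (fun x => Rabs (u x))
  + sup_on ccint (fun x => Rabs (derive_on ccint u x))
  + sup_on ccint (fun x => Rabs (derive_on ccint (derive_on ccint u) x)).

Lemma C2_cont (u : C2) :
  continuous_on ccint u /\ continuous_on ccint (derive_on ccint u)
  /\ continuous_on ccint (derive_on ccint (derive_on ccint u)).
Proof.
assert (H := C2_reg u); split; [|split].
- exact (Ck_on_continuous ccint 2 dense_ccint u H).
- exact (Ck_on_continuous ccint 1 dense_ccint _ (proj2 H)).
- exact (proj2 (proj2 H)).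
Qed.

Lemma C2_lin_derive a b (u v : C2) x : ccint x ->
  derive_on ccint (C2_lin a b u v) x
  = a * derive_on ccint u x + b * derive_on ccint v x.
Proof.
intros Hx; apply (derive_on_lin ccint a b u v x dense_ccint Hx).
- exact (proj1 (C2_reg u) x Hx).
- exact (proj1 (C2_reg v) x Hx).
Qed.

Lemma C2_lin_derive2 a b (u v : C2) x : ccint x ->
  derive_on ccint (derive_on ccint (C2_lin a b u v)) x
  = a * derive_on ccint (derive_on ccint u) x
    + b * derive_on ccint (derive_on ccint v) x.
Proof.
intros Hx.
rewrite (derive_on_ext ccint _
  (fun y => a * derive_on ccint u y + b * derive_on ccint v y) x dense_ccint).
- apply (derive_on_lin ccint a b _ _ x dense_ccint Hx).
  + exact (proj1 (proj2 (C2_reg u)) x Hx).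
  + exact (proj1 (proj2 (C2_reg v)) x Hx).
- intros y Hy; apply C2_lin_derive; exact Hy.
- exact Hx.
- exact (proj1 (proj2 (C2_reg (C2_lin a b u v))) x Hx).
Qed.

Lemma Rabs_lin a b x y : Rabs (a * x + b * y) <= Rabs a * Rabs x + Rabs b * Rabs y.
Proof. eapply Rle_trans; [apply Rabs_triang|]; rewrite !Rabs_mult; apply Rle_refl. Qed.

Lemma C2_norm_lin a b (u v : C2) :
  C2_norm (C2_lin a b u v) <= Rabs a * C2_norm u + Rabs b * C2_norm v.
Proof.
assert (Ha := Rabs_pos a); assert (Hb := Rabs_pos b).
destruct (C2_cont u) as [U0 [U1 U2]], (C2_cont v) as [V0 [V1 V2]],
  (C2_cont (C2_lin a b u v)) as [W0 [W1 W2]].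
unfold C2_norm; rewrite !Rmult_plus_distr_l.
match goal with |- ?p + ?q + ?r <= ?p1 + ?q1 + ?r1 + (?p2 + ?q2 + ?r2) =>
  assert (Hp : p <= p1 + p2); [|assert (Hq : q <= q1 + q2);
    [|assert (Hr : r <= r1 + r2); [|lra]]] end.
- apply sup_abs_lub; [exact W0|]; intros x Hx; simpl.
  eapply Rle_trans; [apply Rabs_lin|].
  apply Rplus_le_compat; apply Rmult_le_compat_l; try assumption;
    apply (sup_abs_ub _ x); assumption.
- apply sup_abs_lub; [exact W1|]; intros x Hx; rewrite C2_lin_derive by exact Hx.
  eapply Rle_trans; [apply Rabs_lin|].
  apply Rplus_le_compat; apply Rmult_le_compat_l; try assumption;
    apply (sup_abs_ub _ x); assumption.
- apply sup_abs_lub; [exact W2|]; intros x Hx; rewrite C2_lin_derive2 by exact Hx.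
  eapply Rle_trans; [apply Rabs_lin|].
  apply Rplus_le_compat; apply Rmult_le_compat_l; try assumption;
    apply (sup_abs_ub _ x); assumption.
Qed.

Lemma C2_norm_ge (u : C2) x : ccint x -> Rabs (u x) <= C2_norm u.
Proof.
intros Hx; destruct (C2_cont u) as [U0 [U1 U2]]; unfold C2_norm.
assert (H0 := sup_abs_ub _ x U0 Hx).
assert (H1 := sup_abs_ub _ x U1 Hx); assert (P1 := Rabs_pos (derive_on ccint u x)).
assert (H2 := sup_abs_ub _ x U2 Hx);
  assert (P2 := Rabs_pos (derive_on ccint (derive_on ccint u) x)).
lra.
Qed.

Definition C2_AbelianMonoid_mixin : AbelianMonoid.mixin_of C2.
Proof.
apply (AbelianMonoid.Mixin C2 C2_plus C2_zero);
  intros; apply C2_eq; intros t; simpl; ring.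
Defined.

Canonical C2_AbelianMonoid := AbelianMonoid.Pack C2 C2_AbelianMonoid_mixin C2.

Definition C2_AbelianGroup_mixin : AbelianGroup.mixin_of C2_AbelianMonoid.
Proof.
apply (AbelianGroup.Mixin C2_AbelianMonoid C2_opp);
  intros; apply C2_eq; intros t; simpl; ring.
Defined.

Canonical C2_AbelianGroup :=
  AbelianGroup.Pack C2 (AbelianGroup.Class C2 _ C2_AbelianGroup_mixin) C2.

Definition C2_ModuleSpace_mixin : ModuleSpace.mixin_of R_Ring C2_AbelianGroup.
Proof.
apply (ModuleSpace.Mixin R_Ring C2_AbelianGroup C2_scal);
  intros; apply C2_eq; intros t; simpl;
  unfold mult, plus, one; simpl; ring.
Defined.

Canonical C2_ModuleSpace :=
  ModuleSpace.Pack R_Ring C2 (ModuleSpace.Class R_Ring C2 _ C2_ModuleSpace_mixin) C2.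

Lemma C2_norm_triangle (u v : C2) : C2_norm (C2_plus u v) <= C2_norm u + C2_norm v.
Proof.
eapply Rle_trans; [apply C2_norm_lin|]; rewrite Rabs_R1; lra.
Qed.

Lemma C2_norm_scal (a : R) (u : C2) : C2_norm (C2_scal a u) <= Rabs a * C2_norm u.
Proof.
eapply Rle_trans; [apply C2_norm_lin|]; rewrite Rabs_R0; lra.
Qed.

Lemma C2_norm_zero : C2_norm C2_zero = 0.
Proof.
apply Rle_antisym.
- assert (H := C2_norm_scal 0 C2_zero).
  replace (C2_scal 0 C2_zero) with C2_zero in H
    by (apply C2_eq; intros t; simpl; ring).
  rewrite Rabs_R0 in H; lra.
- eapply Rle_trans; [|apply (C2_norm_ge _ 0); unfold ccint; lra]; apply Rabs_pos.
Qed.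

Definition C2_ball (u : C2) (e : R) (v : C2) : Prop := C2_norm (minus v u) < e.

Definition C2_UniformSpace_mixin : UniformSpace.mixin_of C2.
Proof.
apply (UniformSpace.Mixin C2 C2_zero C2_ball); unfold C2_ball.
- intros u e; rewrite minus_eq_zero.
  change (C2_norm C2_zero < e); rewrite C2_norm_zero; apply cond_pos.
- intros u v e H; rewrite <- opp_minus.
  eapply Rle_lt_trans; [|exact H].
  eapply Rle_trans; [apply C2_norm_lin|].
  rewrite Rabs_R0, (Rabs_left (-1)); lra.
- intros u v w e1 e2 H1 H2; rewrite (minus_trans v w u).
  eapply Rle_lt_trans; [apply C2_norm_triangle|]; lra.
Defined.

Canonical C2_UniformSpace := UniformSpace.Pack C2 C2_UniformSpace_mixin C2.

Canonical C2_NormedModuleAux :=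
  NormedModuleAux.Pack R_AbsRing C2
    (NormedModuleAux.Class R_AbsRing C2 (ModuleSpace.class _ C2_ModuleSpace)
       C2_UniformSpace_mixin) C2.

Definition C2_NormedModule_mixin : NormedModule.mixin_of R_AbsRing C2_NormedModuleAux.
Proof.
apply (NormedModule.Mixin R_AbsRing C2_NormedModuleAux C2_norm 1).
- exact C2_norm_triangle.
- exact C2_norm_scal.
- intros u v e H; exact H.
- intros u v e H; rewrite Rmult_1_l; exact H.
- intros u H; apply C2_eq; intros x; simpl.
  destruct (Rle_dec (-1) x) as [H1|H1]; [destruct (Rle_dec x 1) as [H2|H2]|].
  + assert (Hx := C2_norm_ge u x (conj H1 H2)); rewrite H in Hx.
    assert (Hp := Rabs_pos (u x)).
    destruct (Req_dec (u x) 0) as [|Hn]; [assumption|].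
    apply Rabs_pos_lt in Hn; lra.
  + apply C2_off; intros [_ ?]; lra.
  + apply C2_off; intros [? _]; lra.
Defined.

Canonical C2_NormedModule :=
  NormedModule.Pack R_AbsRing C2
    (NormedModule.Class R_AbsRing C2 (NormedModuleAux.class _ C2_NormedModuleAux)
       C2_NormedModule_mixin) C2.

Record positive_solution (f g : R -> R) (lam mu : R) (u : R -> R) : Prop := {
  ps_C2 : Ck_on 2 ooint u;
  ps_C1 : Ck_on 1 ccint u;
  ps_eq : forall x, ooint x -> Derive_n u 2 x + lam * f (u x) - mu * g x = 0;
  ps_left : u (-1) = 0;
  ps_right : u 1 = 0;
  ps_pos : forall x, ooint x -> 0 < u x }.

Definition regular_C1_curve {V : NormedModule R_AbsRing} (a b : Rbar) (c : R -> V)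
  : Prop :=
  exists dc : R -> V, forall s : R, Rbar_lt a s -> Rbar_lt s b ->
    is_derive c s (dc s) /\ continuous dc s /\ dc s <> zero.

Definition RxC2 : NormedModule R_AbsRing :=
  prod_NormedModule R_AbsRing R_NormedModule C2_NormedModule.

Definition param (c : R -> RxC2) (s : R) : R := fst (c s).
Definition state (c : R -> RxC2) (s : R) : C2 := snd (c s).

Definition curve_of_solutions (sol : R -> (R -> R) -> Prop) (a b : Rbar)
  (c : R -> RxC2) : Prop :=
  regular_C1_curve a b c /\
  forall s : R, Rbar_lt a s -> Rbar_lt s b ->
    0 < param c s /\ sol (param c s) (state c s)
    /\ derive_on ccint (state c s) 1 < 0.

Definition solution_curve_lambda (f g : R -> R) (mu : R) :=
  curve_of_solutions (fun lam u => positive_solution f g lam mu u).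

Definition solution_curve_mu (f g : R -> R) (lam : R) :=
  curve_of_solutions (fun mu u => positive_solution f g lam mu u).

Definition turns_right (p : R -> R) (s0 : R) : Prop :=
  locally' s0 (fun s => p s > p s0).

Definition turns_left (p : R -> R) (s0 : R) : Prop :=
  locally' s0 (fun s => p s < p s0).

Definition strict_local_min (p : R -> R) (s0 : R) : Prop :=
  locally' s0 (fun s => p s0 < p s).

Definition strict_local_max (p : R -> R) (s0 : R) : Prop :=
  locally' s0 (fun s => p s < p s0).

Definition turns (p : R -> R) (s0 : R) : Prop :=
  strict_local_min p s0 \/ strict_local_max p s0.

Definition only_right_turns (a b : Rbar) (p : R -> R) : Prop :=
  forall s0 : R, Rbar_lt a s0 -> Rbar_lt s0 b -> turns p s0 -> turns_right p s0.

Definition only_left_turns (a b : Rbar) (p : R -> R) : Prop :=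
  forall s0 : R, Rbar_lt a s0 -> Rbar_lt s0 b -> turns p s0 -> turns_left p s0.

(* Main.v *)
Require Import Defs.
From Stdlib Require Import Reals Lra Psatz Lia Classical IndefiniteDescription.
From Coquelicot Require Import Coquelicot.
Open Scope R_scope.

(** Consider a turn at s0 and write u for the solution there. The parameter is
    stationary at s0, so by regularity the tangent of the curve is (0, w) with w not 0,
    and differentiating the equation along the curve shows that w is a null vector of
    the linearised problem: w'' + lam f'(u) w = 0 and w(-1) = w(1) = 0
    ([stationary_null_vector]).

    The null vector has one sign ([positive_null_vector]). Since g is even and increases
    with |x|, moving planes show that u is nonincreasing on [0,1] ([moving_plane],
    [solution_nonincreasing]), and likewise for its mirror image. As u' solves the
    linearised equation with source mu g', the Wronskian of w and u' is monotone past the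
    last zero of w in [0,1), which contradicts its boundary values ([no_last_zero]). So w
    may be taken positive.

    The direction of the turn now follows without a second derivative in s. Let U be
    another solution on the curve, near u, and let
    r = f(U) - f(u) - f'(u) (U - u), which is at most 0 for concave f and at least 0 for
    convex f. Testing the difference of the two equations with w gives
    - for mu fixed: (lam0 - lam) int w (f(u) + f'(u) (U - u)) = lam int w r,
    - for lam fixed: (mu - mu0) int w g = lam int w r.
    In the second identity the weight w g is positive, so mu - mu0 has the sign of
    int w r ([no_solution_mu]). In the first one the term with U - u is small, and
    int w f(u) > 0 is found by testing the linearised equation with x u'
    ([pohozaev_derivative], [no_solution_lam]). Either way the parameter can pass its
    value at s0 on one side only, which excludes one of the two kinds of strict
    extremum. The proofs use monotone functions in place of the integrals, because x g'
    need not be integrable up to the end points. *)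

(** * Calculus on intervals *)

Lemma continuous_pt (h : R -> R) x : continuous h x -> continuity_pt h x.
Proof. intros H; apply continuity_pt_filterlim; exact H. Qed.

Lemma is_derive_continuous (h : R -> R) x l : is_derive h x l -> continuous h x.
Proof. intros H; apply (ex_derive_continuous (V := R_NormedModule)); exists l; exact H. Qed.

Lemma Derive_of (h : R -> R) (x l : R) :
  is_derive h x l -> Derive (fun t : R => h t) x = l.
Proof. exact (is_derive_unique h x l). Qed.

Lemma mean_value (h h' : R -> R) a b : a < b ->
  (forall x, a < x < b -> is_derive h x (h' x)) ->
  (forall x, a <= x <= b -> continuous h x) ->
  exists c, a < c < b /\ h b - h a = h' c * (b - a).
Proof.
intros Hab Hd Hc.
assert (pr1 : forall c, a < c < b -> derivable_pt h c).
{ intros c Hx; exists (h' c); apply is_derive_Reals; auto. }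
assert (pr2 : forall c, a < c < b -> derivable_pt id c).
{ intros c Hx; apply derivable_pt_id. }
destruct (MVT h id a b pr1 pr2 Hab) as [c [P E]].
- intros c Hx; apply continuous_pt; auto.
- intros c Hx; apply derivable_continuous_pt, derivable_pt_id.
- exists c; split; [exact P|].
  assert (E1 : derive_pt h c (pr1 c P) = h' c).
  { apply derive_pt_eq_0, is_derive_Reals; auto. }
  assert (E2 : derive_pt id c (pr2 c P) = 1).
  { apply derive_pt_eq_0, derivable_pt_lim_id. }
  rewrite E1, E2 in E; unfold id in E; lra.
Qed.

Lemma le_of_derive_ge0 (h h' : R -> R) a b : a <= b ->
  (forall x, a < x < b -> is_derive h x (h' x)) ->
  (forall x, a <= x <= b -> continuous h x) ->
  (forall x, a < x < b -> 0 <= h' x) -> h a <= h b.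
Proof.
intros [Hab| ->] Hd Hc Hp; [|lra].
destruct (mean_value h h' a b Hab Hd Hc) as [c [Hc1 Hc2]].
assert (0 <= h' c * (b - a)) by (apply Rmult_le_pos; [auto|lra]); lra.
Qed.

Lemma lt_of_derive_gt0 (h h' : R -> R) a b : a < b ->
  (forall x, a < x < b -> is_derive h x (h' x)) ->
  (forall x, a <= x <= b -> continuous h x) ->
  (forall x, a < x < b -> 0 < h' x) -> h a < h b.
Proof.
intros Hab Hd Hc Hp.
destruct (mean_value h h' a b Hab Hd Hc) as [c [Hc1 Hc2]].
assert (0 < h' c * (b - a)) by (apply Rmult_lt_0_compat; [auto|lra]); lra.
Qed.

Lemma bounded_on_segment (h : R -> R) a b : a <= b ->
  (forall x, continuous h x) -> exists K, 0 <= K /\ forall x, a <= x <= b -> Rabs (h x) <= K.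
Proof.
intros Hab Hc.
destruct (continuity_ab_maj (fun x => Rabs (h x)) a b Hab) as [M [HM _]].
- intros c _; apply continuous_pt.
  apply (continuous_comp h Rabs); [apply Hc|apply continuous_Rabs].
- exists (Rabs (h M)); split; [apply Rabs_pos|exact HM].
Qed.

Lemma continuous_eps (h : R -> R) x e : continuous h x -> 0 < e ->
  exists d, 0 < d /\ forall y, Rabs (y - x) < d -> Rabs (h y - h x) < e.
Proof.
intros Hc He; destruct (Hc (ball (h x) (mkposreal e He))) as [d Hd].
- exists (mkposreal e He); intros z Hz; exact Hz.
- exists d; split; [apply cond_pos|]; intros y Hy; exact (Hd y Hy).
Qed.

Lemma continuous_pos_near (h : R -> R) x : continuous h x -> 0 < h x ->
  exists d, 0 < d /\ forall y, Rabs (y - x) < d -> 0 < h y.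
Proof.
intros Hc Hp; destruct (continuous_eps h x (h x) Hc Hp) as [d [Hd H]].
exists d; split; [exact Hd|]; intros y Hy; specialize (H y Hy).
apply Rabs_def2 in H; lra.
Qed.

Lemma nonzero_near (h : R -> R) x : continuous h x -> h x <> 0 ->
  exists d, 0 < d /\ forall y, Rabs (y - x) < d -> h y <> 0.
Proof.
intros Hc Hn; destruct (continuous_eps h x (Rabs (h x)) Hc (Rabs_pos_lt _ Hn)) as [d [Hd H]].
exists d; split; [exact Hd|]; intros y Hy E; specialize (H y Hy).
rewrite E in H; replace (0 - h x) with (- h x) in H by ring; rewrite Rabs_Ropp in H; lra.
Qed.

Lemma constant_sign (h : R -> R) a b m : (forall x, continuous h x) -> a < m < b -> 0 < h m ->
  (forall x, a < x < b -> h x <> 0) -> forall x, a < x < b -> 0 < h x.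
Proof.
intros Hc Hm Hpos Hn x Hx; apply Rnot_le_lt; intros Hle.
destruct (IVT_gen h x m 0) as [z [Hz Hz0]].
- intros y; apply continuous_pt, Hc.
- rewrite Rmin_left, Rmax_right by lra; lra.
- apply (Hn z); [|exact Hz0].
  assert (A1 := Rmin_glb_lt x m a ltac:(lra) ltac:(lra)).
  assert (A2 := Rmax_lub_lt x m b ltac:(lra) ltac:(lra)); lra.
Qed.

Lemma is_derive_reflect (h h' : R -> R) t x :
  is_derive h (t - x) (h' (t - x)) -> is_derive (fun x => h (t - x)) x (- h' (t - x)).
Proof.
intros H; replace (- h' (t - x)) with (scal (-1) (h' (t - x)))
  by (unfold scal; simpl; unfold mult; simpl; ring).
apply (is_derive_comp h (fun x => t - x)); [exact H|].
auto_derive; [exact I|ring].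
Qed.

Lemma right_end_slope (h h1 : R -> R) a b : a < b ->
  (forall x, is_derive h x (h1 x)) -> continuous h1 b ->
  (forall x, a < x < b -> h b <= h x) -> h1 b <= 0.
Proof.
intros Hab Hd Hc Hle; apply Rnot_lt_le; intros Hlt.
destruct (continuous_pos_near h1 b Hc Hlt) as [d [Hd0 Hpos]].
assert (M1 := Rmin_l d (b - a)); assert (M2 := Rmin_r d (b - a)).
assert (M3 : 0 < Rmin d (b - a)) by (apply Rmin_pos; lra).
set (x := b - Rmin d (b - a) / 2).
assert (h x < h b).
{ apply (lt_of_derive_gt0 h h1); unfold x; try lra.
  - intros z _; apply Hd.
  - intros z _; exact (is_derive_continuous _ _ _ (Hd z)).
  - intros z Hz; apply Hpos, Rabs_def1; lra. }
assert (h b <= h x) by (apply Hle; unfold x; lra); lra.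
Qed.

Lemma left_end_slope (h h1 : R -> R) a b : a < b ->
  (forall x, is_derive h x (h1 x)) -> continuous h1 a ->
  (forall x, a < x < b -> h a <= h x) -> 0 <= h1 a.
Proof.
intros Hab Hd Hc Hle.
assert (H : - h1 (0 - - a) <= 0).
{ apply (right_end_slope (fun x => h (0 - x)) (fun x => - h1 (0 - x)) (- b) (- a)).
  - lra.
  - intros x; apply is_derive_reflect, Hd.
  - apply (continuous_opp (fun x => h1 (0 - x))).
    apply (continuous_comp (fun x => 0 - x) h1).
    + apply (is_derive_continuous _ _ (-1)); auto_derive; [exact I|ring].
    + replace (0 - - a) with a by ring; exact Hc.
  - intros x Hx; replace (0 - - a) with a by ring; apply Hle; lra. }
replace (0 - - a) with a in H by ring; lra.
Qed.

Lemma segment_locally a b x : a < x < b -> locally x (fun y => a < y < b).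
Proof.
apply (locally_open (fun y => a < y < b) (fun y => a < y < b)); [|auto].
apply open_and; [apply open_gt|apply open_lt].
Qed.

(** The derivatives are functions on the whole line, so that the boundary of [-1,1]
    needs no one-sided calculus; a function given only on [-1,1] is extended first. *)
Definition C2_jet (u u1 u2 : R -> R) : Prop :=
  (forall x, is_derive u x (u1 x)) /\ (forall x, is_derive u1 x (u2 x)) /\
  (forall x, continuous u2 x).

Lemma jet_cont u u1 u2 x : C2_jet u u1 u2 -> continuous u x.
Proof. intros [H _]; exact (is_derive_continuous _ _ _ (H x)). Qed.

Lemma jet_cont1 u u1 u2 x : C2_jet u u1 u2 -> continuous u1 x.
Proof. intros [_ [H _]]; exact (is_derive_continuous _ _ _ (H x)). Qed.

Lemma jet_cont2 u u1 u2 x : C2_jet u u1 u2 -> continuous u2 x.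
Proof. intros [_ [_ H]]; apply H. Qed.

Lemma jet_minus u u1 u2 v v1 v2 : C2_jet u u1 u2 -> C2_jet v v1 v2 ->
  C2_jet (fun x => u x - v x) (fun x => u1 x - v1 x) (fun x => u2 x - v2 x).
Proof.
intros [Hu [Hu1 Hu2]] [Hv [Hv1 Hv2]]; split; [|split]; intros x.
- apply (is_derive_minus u v); auto.
- apply (is_derive_minus u1 v1); auto.
- apply (continuous_minus u2 v2); auto.
Qed.

Lemma jet_opp u u1 u2 : C2_jet u u1 u2 ->
  C2_jet (fun x => - u x) (fun x => - u1 x) (fun x => - u2 x).
Proof.
intros [Hu [Hu1 Hu2]]; split; [|split]; intros x.
- apply (is_derive_opp u); auto.
- apply (is_derive_opp u1); auto.
- apply (continuous_opp u2); auto.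
Qed.

Lemma jet_reflect t u u1 u2 : C2_jet u u1 u2 ->
  C2_jet (fun x => u (t - x)) (fun x => - u1 (t - x)) (fun x => u2 (t - x)).
Proof.
intros [Hu [Hu1 Hu2]]; split; [|split]; intros x.
- apply is_derive_reflect; auto.
- replace (u2 (t - x)) with (- - u2 (t - x)) by ring.
  apply (is_derive_opp (fun x => u1 (t - x))), is_derive_reflect; auto.
- apply (continuous_comp (fun x => t - x) u2); [|auto].
  apply (is_derive_continuous _ _ (-1)); auto_derive; [exact I|ring].
Qed.

Lemma jet_wronskian_continuous w w1 w2 v v1 v2 x : C2_jet w w1 w2 -> C2_jet v v1 v2 ->
  continuous (fun x => w x * v1 x - w1 x * v x) x.
Proof.
intros JW JV; apply (continuous_minus (fun x => w x * v1 x) (fun x => w1 x * v x)).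
- apply (continuous_mult w v1); [exact (jet_cont _ _ _ _ JW)|exact (jet_cont1 _ _ _ _ JV)].
- apply (continuous_mult w1 v); [exact (jet_cont1 _ _ _ _ JW)|exact (jet_cont _ _ _ _ JV)].
Qed.

(** Since y'' - k^2 y = (d/dx - k) (d/dx + k) y, zero Cauchy data at [a] propagate
    the sign through two first order inequalities, each solved by an exponential.
    This plays the part of the strong maximum principle and of the Hopf lemma. *)
Lemma barrier y y1 y2 k a b : C2_jet y y1 y2 -> a <= b ->
  (forall x, a < x < b -> y2 x <= k * k * y x) -> y a = 0 -> y1 a = 0 -> y b <= 0.
Proof.
intros HJ Hab Hy Ha Ha1.
destruct HJ as [Hd [Hd1 _]].
assert (Hz : forall x, a <= x <= b -> y1 x + k * y x <= 0).
{ intros x Hx.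
  assert (D : forall z, is_derive (fun x => - (exp (- k * x) * (y1 x + k * y x))) z
                (exp (- k * z) * (k * k * y z - y2 z))).
  { intros z; auto_derive.
    - repeat split; [exists (y2 z)|exists (y1 z)]; auto.
    - rewrite (Derive_of _ _ _ (Hd1 z)),
        (Derive_of _ _ _ (Hd z)); ring. }
  assert (H := le_of_derive_ge0 _ _ a x (proj1 Hx) (fun z _ => D z)
                 (fun z _ => is_derive_continuous _ _ _ (D z))).
  cbv beta in H; rewrite Ha, Ha1 in H.
  assert (He := exp_pos (- k * x)).
  assert (0 <= - (exp (- k * x) * (y1 x + k * y x))).
  { eapply Rle_trans; [|apply H]; [right; ring|].
    intros z Hz; apply Rmult_le_pos; [left; apply exp_pos|].
    assert (y2 z <= k * k * y z) by (apply Hy; lra); lra. }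
  nra. }
assert (D : forall z, is_derive (fun x => - (exp (k * x) * y x)) z
              (exp (k * z) * - (y1 z + k * y z))).
{ intros z; auto_derive.
  - repeat split; exists (y1 z); auto.
  - rewrite (Derive_of _ _ _ (Hd z)); ring. }
assert (H := le_of_derive_ge0 _ _ a b Hab (fun z _ => D z)
               (fun z _ => is_derive_continuous _ _ _ (D z))).
cbv beta in H; rewrite Ha in H.
assert (He := exp_pos (k * b)).
assert (0 <= - (exp (k * b) * y b)).
{ eapply Rle_trans; [|apply H]; [right; ring|].
  intros z Hz'; apply Rmult_le_pos; [left; apply exp_pos|].
  assert (y1 z + k * y z <= 0) by (apply Hz; lra); lra. }
nra.
Qed.

(** Uniqueness for the backward Cauchy problem: the energy w^2 + w'^2 satisfies
    a linear differential inequality. *)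
Lemma cauchy_unique w w1 w2 (q : R -> R) K a b : C2_jet w w1 w2 -> a <= b ->
  (forall x, a < x < b -> w2 x = - q x * w x) ->
  (forall x, a < x < b -> Rabs (q x) <= K) ->
  w b = 0 -> w1 b = 0 -> w a = 0.
Proof.
intros HJ Hab Hw Hq Hb Hb1.
destruct HJ as [Hd [Hd1 _]].
assert (D : forall z, is_derive (fun x => exp ((1 + K) * x) * (w x * w x + w1 x * w1 x)) z
   (exp ((1 + K) * z) * ((1 + K) * (w z * w z + w1 z * w1 z) + 2 * w1 z * (w z + w2 z)))).
{ intros z; auto_derive.
  - repeat split; first [exists (w2 z); now auto|exists (w1 z); now auto].
  - rewrite (Derive_of _ _ _ (Hd z)),
      (Derive_of _ _ _ (Hd1 z)); ring. }
assert (H := le_of_derive_ge0 _ _ a b Hab (fun z _ => D z)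
               (fun z _ => is_derive_continuous _ _ _ (D z))).
cbv beta in H; rewrite Hb, Hb1 in H.
assert (He := exp_pos ((1 + K) * a)).
assert (exp ((1 + K) * a) * (w a * w a + w1 a * w1 a) <= 0).
{ eapply Rle_trans; [apply H|right; ring].
  intros z Hz; apply Rmult_le_pos; [left; apply exp_pos|].
  rewrite (Hw z Hz); assert (Hqz := Hq z Hz).
  replace (w z + - q z * w z) with ((1 - q z) * w z) by ring.
  assert (Hc : -(1 + K) <= 1 - q z <= 1 + K).
  { assert (H1 := Rle_abs (q z)); assert (H2 := Rle_abs (- q z));
    rewrite Rabs_Ropp in H2; lra. }
  set (c := 1 - q z) in *; set (p := w z); set (r := w1 z).
  replace ((1 + K) * (p * p + r * r) + 2 * r * (c * p))
    with ((1 + K + c) / 2 * (p + r)² + (1 + K - c) / 2 * (p - r)²)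
    by (unfold Rsqr; field).
  apply Rplus_le_le_0_compat; apply Rmult_le_pos; (apply Rle_0_sqr || lra). }
assert (0 <= w1 a * w1 a) by nra.
assert (w a * w a <= 0) by nra.
nra.
Qed.

(** * Symmetry and monotonicity of positive solutions *)

Record even_forcing (g g1 : R -> R) : Prop := {
  ef_der : forall x, -1 < x < 1 -> is_derive g x (g1 x);
  ef_even : forall x, -1 < x < 1 -> g (- x) = g x;
  ef_sign : forall x, -1 < x < 1 -> 0 <= x * g1 x;
  ef_pos : 0 < g 0 }.

Arguments ef_der {g g1} _.
Arguments ef_even {g g1} _.
Arguments ef_sign {g g1} _.
Arguments ef_pos {g g1} _.

Lemma forcing_mono g g1 x y : even_forcing g g1 -> Rabs x <= Rabs y -> Rabs y < 1 -> g x <= g y.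
Proof.
intros G Hxy Hy.
assert (E : forall z, Rabs z < 1 -> g (Rabs z) = g z).
{ intros z Hz; unfold Rabs in Hz |- *; destruct (Rcase_abs z); [|reflexivity].
  apply (ef_even G); lra. }
rewrite <- (E x), <- (E y) by lra.
assert (Hx0 := Rabs_pos x).
apply (le_of_derive_ge0 g g1); [exact Hxy| | |].
- intros z Hz; apply (ef_der G); lra.
- intros z Hz; apply (is_derive_continuous _ _ (g1 z)), (ef_der G); lra.
- intros z Hz; assert (H := ef_sign G z ltac:(lra)); nra.
Qed.

Lemma forcing_pos g g1 x : even_forcing g g1 -> -1 < x < 1 -> 0 < g x.
Proof.
intros G Hx; apply Rlt_le_trans with (g 0); [apply (ef_pos G)|].
apply (forcing_mono g g1); [exact G| |]; rewrite ?Rabs_R0; [apply Rabs_pos|].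
apply Rabs_def1; lra.
Qed.

Definition C1_jet (F F1 : R -> R) : Prop :=
  (forall y, is_derive F y (F1 y)) /\ (forall y, continuous F1 y).

Lemma C1_lipschitz F F1 a b : C1_jet F F1 -> a <= b ->
  exists L, 0 <= L /\ forall x y, a <= x -> x <= y -> y <= b -> F x - F y <= L * (y - x).
Proof.
intros [Hd Hc] Hab; destruct (bounded_on_segment F1 a b Hab Hc) as [L [HL HF]].
exists L; split; [exact HL|]; intros x y Hx [Hxy| ->] Hy; [|lra].
destruct (mean_value F F1 x y Hxy (fun z _ => Hd z)
            (fun z _ => is_derive_continuous _ _ _ (Hd z))) as [c [Hc1 Hc2]].
assert (H := HF c ltac:(lra)); assert (H1 := Rle_abs (- F1 c)); rewrite Rabs_Ropp in H1.
nra.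
Qed.

Record classical_solution (F g : R -> R) (lam mu : R) (u u1 u2 : R -> R) : Prop := {
  cs_jet : C2_jet u u1 u2;
  cs_eq : forall x, -1 < x < 1 -> u2 x = mu * g x - lam * F (u x);
  cs_left : u (-1) = 0;
  cs_right : u 1 = 0;
  cs_pos : forall x, -1 < x < 1 -> 0 < u x }.

Arguments cs_jet {F g lam mu u u1 u2} _.
Arguments cs_eq {F g lam mu u u1 u2} _.
Arguments cs_left {F g lam mu u u1 u2} _.
Arguments cs_right {F g lam mu u u1 u2} _.
Arguments cs_pos {F g lam mu u u1 u2} _.

Lemma solution_reflect F g g1 lam mu u u1 u2 : even_forcing g g1 ->
  classical_solution F g lam mu u u1 u2 ->
  classical_solution F g lam mu (fun x => u (0 - x)) (fun x => - u1 (0 - x))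
    (fun x => u2 (0 - x)).
Proof.
intros G [J E L R P]; split.
- apply jet_reflect; exact J.
- intros x Hx; rewrite (E (0 - x)) by lra.
  replace (0 - x) with (- x) by ring; rewrite (ef_even G) by exact Hx; reflexivity.
- replace (0 - -1) with 1 by ring; exact R.
- replace (0 - 1) with (-1) by ring; exact L.
- intros x Hx; apply P; lra.
Qed.

(** A pair (t, x) at which reflecting about [t] goes wrong, normalised so that
    [x] is a critical point of the difference u(2t - x) - u(x): this equation
    survives in the limit, where the strict inequality does not. *)
Definition bad_pair (u u1 : R -> R) (t x : R) : Prop :=
  0 < t < 1 /\ t <= x <= 1 /\ u (2 * t - x) < u x /\ u1 (2 * t - x) + u1 x = 0.

(** The difference u(2t - x) - u(x) is 0 at x = t and positive at x = 1, so a negative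
    minimum is attained in between. *)
Lemma bad_pair_exists F g lam mu u u1 u2 t x : classical_solution F g lam mu u u1 u2 ->
  0 < t < 1 -> t <= x <= 1 -> u (2 * t - x) < u x -> exists y, bad_pair u u1 t y.
Proof.
intros S Ht Hx Hbad.
set (h := fun x => u (2 * t - x) - u x).
assert (J := cs_jet S); destruct J as [Hd _].
assert (D : forall z, is_derive h z (- u1 (2 * t - z) - u1 z)).
{ intros z; apply (is_derive_minus (fun x => u (2 * t - x)) u);
    [apply is_derive_reflect|]; apply Hd. }
destruct (continuity_ab_min h t 1) as [m [Hm1 Hm2]]; [lra| |].
{ intros c _; apply continuous_pt; exact (is_derive_continuous _ _ _ (D c)). }
assert (Hm : h m < 0) by (assert (H := Hm1 x Hx); unfold h in *; lra).
assert (Hmt : t < m).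
{ destruct (Rle_lt_or_eq_dec t m (proj1 Hm2)) as [|<-]; [assumption|].
  exfalso; unfold h in Hm; replace (2 * t - t) with t in Hm by ring; lra. }
assert (Hm3 : m < 1).
{ destruct (Rle_lt_or_eq_dec m 1 (proj2 Hm2)) as [|E]; [assumption|].
  exfalso; rewrite E in Hm; unfold h in Hm; rewrite (cs_right S) in Hm.
  assert (H := cs_pos S (2 * t - 1) ltac:(lra)); lra. }
exists m; unfold bad_pair; repeat split; try lra; [unfold h in Hm; lra|].
assert (pr : derivable_pt h m).
{ eexists; apply is_derive_Reals, D. }
assert (H := deriv_minimum h t 1 m pr Hmt Hm3 (fun z Hz Hz' => Hm1 z ltac:(lra))).
rewrite (derive_pt_eq_0 h m (- u1 (2 * t - m) - u1 m) pr) in H; [lra|].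
apply is_derive_Reals, D.
Qed.

(** Compactness in the second variable: this locates the point where a family of bad
    pairs degenerates. *)
Lemma accumulation (P : R -> R -> Prop) tau :
  (forall t x, P t x -> 0 <= x <= 1) ->
  (forall e, 0 < e -> exists t x, P t x /\ Rabs (t - tau) < e) ->
  exists x0, forall e, 0 < e -> exists t x, P t x /\ Rabs (t - tau) < e /\ Rabs (x - x0) < e.
Proof.
intros HP H.
destruct (functional_choice (fun (n : nat) (p : R * R) =>
  P (fst p) (snd p) /\ Rabs (fst p - tau) < / INR (S n))) as [q Hq].
{ intros n; destruct (H (/ INR (S n))) as [t [x Htx]].
  - apply Rinv_0_lt_compat, lt_0_INR, Nat.lt_0_succ.
  - exists (t, x); exact Htx. }
destruct (Bolzano_Weierstrass (fun n => snd (q n)) (fun x => 0 <= x <= 1) (compact_P3 0 1))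
  as [x0 Hx0].
{ intros n; apply (HP (fst (q n))), Hq. }
exists x0; intros e He.
destruct (archimed_cor1 e He) as [N [HN HN0]].
destruct (Hx0 (disc x0 (mkposreal e He)) N) as [p [Hp Hpx]].
{ exists (mkposreal e He); intros z Hz; exact Hz. }
exists (fst (q p)), (snd (q p)); destruct (Hq p) as [Hq1 Hq2]; split; [exact Hq1|split].
- eapply Rlt_trans; [exact Hq2|]; eapply Rle_lt_trans; [|exact HN].
  apply Rinv_le_contravar; [apply lt_0_INR; exact HN0|apply le_INR; lia].
- exact Hpx.
Qed.

Lemma limit_le (P : R -> R -> Prop) (h k : R -> R) a b tau x0 :
  (forall e, 0 < e -> exists t x, P t x /\ Rabs (t - tau) < e /\ Rabs (x - x0) < e) ->
  continuous h (2 * tau - x0) -> continuous k x0 ->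
  (forall t x, P t x -> a * h (2 * t - x) + b * k x <= 0) ->
  a * h (2 * tau - x0) + b * k x0 <= 0.
Proof.
intros H Hh Hk Hle; apply Rnot_lt_le; intros Hlt.
set (c := a * h (2 * tau - x0) + b * k x0) in *.
set (M := Rabs a + Rabs b + 1).
assert (HM : 0 < M) by (assert (H1 := Rabs_pos a); assert (H2 := Rabs_pos b); unfold M; lra).
assert (He : 0 < c / M) by (apply Rdiv_lt_0_compat; lra).
destruct (continuous_eps h _ _ Hh He) as [d1 [Hd1 H1]].
destruct (continuous_eps k _ _ Hk He) as [d2 [Hd2 H2]].
assert (Hd : 0 < Rmin (d1 / 3) d2) by (apply Rmin_pos; lra).
destruct (H _ Hd) as [t [x [HP [Ht Hx]]]].
assert (A1 := Rmin_l (d1 / 3) d2); assert (A2 := Rmin_r (d1 / 3) d2).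
assert (B1 : Rabs (h (2 * t - x) - h (2 * tau - x0)) < c / M).
{ apply H1; apply Rabs_def2 in Ht; apply Rabs_def2 in Hx; apply Rabs_def1; lra. }
assert (B2 : Rabs (k x - k x0) < c / M) by (apply H2; lra).
assert (B := Hle t x HP).
assert (C1 : Rabs (a * (h (2 * t - x) - h (2 * tau - x0)) + b * (k x - k x0))
             <= Rabs a * (c / M) + Rabs b * (c / M)).
{ eapply Rle_trans; [apply Rabs_triang|]; rewrite !Rabs_mult.
  apply Rplus_le_compat; apply Rmult_le_compat_l; try apply Rabs_pos; lra. }
assert (C2 : Rabs a * (c / M) + Rabs b * (c / M) = c - c / M).
{ unfold M; field; fold M; lra. }
assert (C3 := Rle_abs (- (a * (h (2 * t - x) - h (2 * tau - x0)) + b * (k x - k x0)))).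
rewrite Rabs_Ropp in C3; unfold c in *; lra.
Qed.

(** The method of moving planes. Let [tau] be the supremum of the bad reflection
    points. Bad pairs accumulate at some (tau, x0), where y(x) = u(2 tau - x) - u(x)
    is at most 0 and stationary. If tau = 1 this says u'(1) = 0. If tau < 1 then
    y >= 0 on [tau, 1] by the choice of [tau], so y and y' vanish at x0; since g
    increases with |x|, y also satisfies y'' <= lam L y with L a Lipschitz constant of
    [F], and [barrier] gives y(1) <= 0 against y(1) = u(2 tau - 1) > 0. *)
Lemma moving_plane F F1 g g1 lam mu u u1 u2 : C1_jet F F1 -> even_forcing g g1 ->
  0 < lam -> 0 < mu -> classical_solution F g lam mu u u1 u2 -> u1 1 < 0 ->
  forall t x, 0 < t < 1 -> t <= x <= 1 -> u x <= u (2 * t - x).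
Proof.
intros HF G Hlam Hmu S Hu1 t x Ht Hx; apply Rnot_lt_le; intros Hbad.
set (B := fun t => exists x, bad_pair u u1 t x).
assert (HB : forall t x, 0 < t < 1 -> t <= x <= 1 -> u (2 * t - x) < u x -> B t)
  by (intros s z; apply (bad_pair_exists F g lam mu u u1 u2 s z S)).
destruct (completeness B) as [tau [Hub Hlub]].
{ exists 1; intros s [z [Hs _]]; lra. }
{ exists t; exact (HB t x Ht Hx Hbad). }
assert (Htau0 : 0 < tau) by (apply Rlt_le_trans with t; [lra|apply Hub, (HB t x Ht Hx Hbad)]).
assert (Htau1 : tau <= 1) by (apply Hlub; intros s [z [Hs _]]; lra).
destruct (accumulation (bad_pair u u1) tau) as [x0 Hx0].
{ intros s z [Hs [Hz _]]; lra. }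
{ intros e He; apply NNPP; intros Hn.
  assert (tau <= tau - e); [|lra].
  apply Hlub; intros s Hs; apply Rnot_lt_le; intros Hlt; apply Hn.
  assert (Hs' := Hub s Hs); destruct Hs as [z Hz]; exists s, z; split; [exact Hz|].
  apply Rabs_def1; lra. }
assert (J := cs_jet S).
assert (C : forall z, continuous u z) by (intros z; exact (jet_cont _ _ _ z J)).
assert (C1 : forall z, continuous u1 z) by (intros z; exact (jet_cont1 _ _ _ z J)).
assert (Cid : forall z, continuous (fun y : R => y) z) by (intros z; apply continuous_id).
assert (I1 : tau <= x0).
{ assert (H := limit_le _ (fun y => y) (fun y => y) (1/2) (-1/2) tau x0 Hx0 (Cid _) (Cid _)).
  cut (1/2 * (2 * tau - x0) + -1/2 * x0 <= 0); [lra|apply H].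
  intros s z [Hs [Hz _]]; lra. }
assert (I2 : x0 <= 1).
{ apply Rnot_lt_le; intros Hlt; destruct (Hx0 (x0 - 1)) as [s [z [[_ [Hz _]] [_ Hz']]]]; [lra|].
  apply Rabs_def2 in Hz'; lra. }
assert (I3 : u (2 * tau - x0) <= u x0).
{ assert (H := limit_le _ u u 1 (-1) tau x0 Hx0 (C _) (C _)).
  cut (1 * u (2 * tau - x0) + -1 * u x0 <= 0); [lra|apply H].
  intros s z [_ [_ [Hz _]]]; lra. }
assert (I4 : u1 (2 * tau - x0) + u1 x0 = 0).
{ assert (H := limit_le _ u1 u1 1 1 tau x0 Hx0 (C1 _) (C1 _)).
  assert (H' := limit_le _ u1 u1 (-1) (-1) tau x0 Hx0 (C1 _) (C1 _)).
  apply Rle_antisym.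
  - cut (1 * u1 (2 * tau - x0) + 1 * u1 x0 <= 0); [lra|apply H].
    intros s z [_ [_ [_ Hz]]]; lra.
  - cut (-1 * u1 (2 * tau - x0) + -1 * u1 x0 <= 0); [lra|apply H'].
    intros s z [_ [_ [_ Hz]]]; lra. }
destruct (Rle_lt_or_eq_dec tau 1 Htau1) as [Hlt|E].
2:{ replace x0 with 1 in I4 by lra; rewrite E in I4.
    replace (2 * 1 - 1) with 1 in I4 by ring; lra. }
(* Reflections about points beyond [tau] are good; pass to the limit. *)
assert (Pos : forall z, tau <= z <= 1 -> u z <= u (2 * tau - z)).
{ intros z Hz; destruct (Rle_lt_or_eq_dec tau z (proj1 Hz)) as [Hz'|<-].
  2:{ right; f_equal; ring. }
  apply Rnot_lt_le; intros Hn.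
  destruct (continuous_eps u (2 * tau - z) (u z - u (2 * tau - z)) (C _)) as [d [Hd Hd']]; [lra|].
  assert (M1 := Rmin_l (d / 2) (z - tau)); assert (M2 := Rmin_r (d / 2) (z - tau)).
  assert (M3 : 0 < Rmin (d / 2) (z - tau)) by (apply Rmin_pos; lra).
  set (s := tau + Rmin (d / 2) (z - tau) / 2).
  assert (B s).
  { apply (HB s z); unfold s; try lra.
    assert (H : Rabs (u (2 * s - z) - u (2 * tau - z)) < u z - u (2 * tau - z)).
    { apply Hd'; unfold s; apply Rabs_def1; lra. }
    apply Rabs_def2 in H; unfold s in H; lra. }
  assert (s <= tau) by (apply Hub; assumption); unfold s in *; lra. }
destruct (bounded_on_segment u (-1) 1 ltac:(lra) C) as [M [HM HuM]].
destruct (C1_lipschitz F F1 0 M HF HM) as [L [HL HFL]].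
set (k := 1 + lam * L).
assert (HlL : 0 <= lam * L) by (apply Rmult_le_pos; lra).
assert (Hy : u (2 * tau - 1) - u 1 <= 0).
{ assert (J' : C2_jet (fun x => u (2 * tau - x) - u x)
            (fun x => - u1 (2 * tau - x) - u1 x) (fun x => u2 (2 * tau - x) - u2 x)).
  { apply jet_minus; [apply (jet_reflect (2 * tau))|]; exact J. }
  apply (barrier _ _ _ k x0 1 J' I2).
  - intros z Hz.
    rewrite !(cs_eq S) by lra.
    assert (Pz := Pos z ltac:(lra)).
    assert (g (2 * tau - z) <= g z).
    { apply (forcing_mono g g1 _ _ G); rewrite (Rabs_pos_eq z) by lra; [|lra].
      apply Rabs_le; lra. }
    assert (U1 := cs_pos S z ltac:(lra)).
    assert (U2 := HuM (2 * tau - z) ltac:(lra)); rewrite Rabs_pos_eq in U2 by lra.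
    assert (HLip := HFL (u z) (u (2 * tau - z)) ltac:(lra) Pz U2).
    set (y := u (2 * tau - z) - u z) in *.
    assert (0 <= y) by (unfold y; lra).
    assert (mu * g (2 * tau - z) <= mu * g z) by (apply Rmult_le_compat_l; lra).
    assert (lam * (F (u z) - F (u (2 * tau - z))) <= lam * (L * y))
      by (apply Rmult_le_compat_l; lra).
    assert (lam * L <= k * k) by (unfold k; nra).
    assert (lam * L * y <= k * k * y) by (apply Rmult_le_compat_r; lra).
    lra.
  - assert (H := Pos x0 ltac:(lra)); lra.
  - lra. }
assert (H := cs_pos S (2 * tau - 1) ltac:(lra)).
rewrite (cs_right S) in Hy; lra.
Qed.

Lemma solution_nonincreasing F F1 g g1 lam mu u u1 u2 : C1_jet F F1 -> even_forcing g g1 ->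
  0 < lam -> 0 < mu -> classical_solution F g lam mu u u1 u2 -> u1 1 < 0 ->
  forall x, 0 <= x <= 1 -> u1 x <= 0.
Proof.
intros HF G Hlam Hmu S Hu1 x Hx.
assert (MP := moving_plane F F1 g g1 lam mu u u1 u2 HF G Hlam Hmu S Hu1).
assert (Mono : forall y z, 0 <= y -> y < z -> z <= 1 -> u z <= u y).
{ intros y z Hy Hyz Hz; replace (u y) with (u (2 * ((y + z) / 2) - z)) by (f_equal; field).
  apply MP; lra. }
assert (J := cs_jet S).
destruct (Rle_lt_or_eq_dec 0 x (proj1 Hx)) as [H0|<-].
- apply (right_end_slope u u1 0 x H0 (proj1 J) (jet_cont1 _ _ _ _ J)).
  intros z Hz; apply Mono; lra.
- assert (0 <= - u1 0); [|lra].
  assert (J' := jet_opp _ _ _ J).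
  apply (left_end_slope _ _ 0 1 Rlt_0_1 (proj1 J') (jet_cont1 _ _ _ _ J')).
  intros z Hz; assert (u z <= u 0) by (apply Mono; lra); lra.
Qed.

(** Letting the reflection point tend to 0 in [moving_plane] gives u(x) <= u(-x), with
    equality at 1, hence u'(-1) >= - u'(1). So the mirror image of u has a negative slope
    at 1 as well, and what holds on [0,1] can be transferred to [-1,0]. *)
Lemma solution_slope_left F F1 g g1 lam mu u u1 u2 : C1_jet F F1 -> even_forcing g g1 ->
  0 < lam -> 0 < mu -> classical_solution F g lam mu u u1 u2 -> u1 1 < 0 -> 0 < u1 (-1).
Proof.
intros HF G Hlam Hmu S Hu1.
assert (MP := moving_plane F F1 g g1 lam mu u u1 u2 HF G Hlam Hmu S Hu1).
assert (J := cs_jet S).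
assert (Le : forall x, 0 < x < 1 -> u x <= u (0 - x)).
{ intros x Hx; apply Rnot_lt_le; intros Hlt.
  destruct (continuous_eps u (0 - x) (u x - u (0 - x)) (jet_cont _ _ _ _ J)) as [d [Hd H]]; [lra|].
  assert (M1 := Rmin_l (d / 2) x); assert (M2 := Rmin_r (d / 2) x).
  assert (M3 : 0 < Rmin (d / 2) x) by (apply Rmin_pos; lra).
  set (t := Rmin (d / 2) x / 2).
  assert (H1 : Rabs (u (2 * t - x) - u (0 - x)) < u x - u (0 - x)).
  { apply H; unfold t; apply Rabs_def1; lra. }
  assert (H2 : u x <= u (2 * t - x)) by (apply MP; unfold t; lra).
  apply Rabs_def2 in H1; lra. }
assert (J' := jet_minus _ _ _ _ _ _ (jet_reflect 0 _ _ _ J) J).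
assert (- u1 (0 - 1) - u1 1 <= 0).
{ apply (right_end_slope _ _ 0 1 Rlt_0_1 (proj1 J') (jet_cont1 _ _ _ _ J')).
  intros x Hx; replace (0 - 1) with (-1) by ring.
  rewrite (cs_left S), (cs_right S).
  assert (H := Le x Hx); lra. }
replace (0 - 1) with (-1) in * by ring; lra.
Qed.

(** * The linearised problem *)

Record null_vector (F1 : R -> R) (lam : R) (u w w1 w2 : R -> R) : Prop := {
  nv_jet : C2_jet w w1 w2;
  nv_eq : forall x, -1 < x < 1 -> w2 x = - (lam * F1 (u x)) * w x;
  nv_left : w (-1) = 0;
  nv_right : w 1 = 0;
  nv_nonzero : exists x, -1 <= x <= 1 /\ w x <> 0 }.

Arguments nv_jet {F1 lam u w w1 w2} _.
Arguments nv_eq {F1 lam u w w1 w2} _.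
Arguments nv_left {F1 lam u w w1 w2} _.
Arguments nv_right {F1 lam u w w1 w2} _.
Arguments nv_nonzero {F1 lam u w w1 w2} _.

Lemma null_vector_opp F1 lam u w w1 w2 : null_vector F1 lam u w w1 w2 ->
  null_vector F1 lam u (fun x => - w x) (fun x => - w1 x) (fun x => - w2 x).
Proof.
intros [J E L R [x [Hx Hn]]]; split.
- apply jet_opp; exact J.
- intros y Hy; rewrite (E y Hy); ring.
- rewrite L; ring.
- rewrite R; ring.
- exists x; split; [exact Hx|lra].
Qed.

Lemma null_vector_reflect F1 lam u w w1 w2 : null_vector F1 lam u w w1 w2 ->
  null_vector F1 lam (fun x => u (0 - x)) (fun x => w (0 - x)) (fun x => - w1 (0 - x))
    (fun x => w2 (0 - x)).
Proof.
intros [J E L R [x [Hx Hn]]]; split.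
- apply jet_reflect; exact J.
- intros y Hy; apply E; lra.
- replace (0 - -1) with 1 by ring; exact R.
- replace (0 - 1) with (-1) by ring; exact L.
- exists (- x); split; [lra|]; replace (0 - - x) with x by ring; exact Hn.
Qed.

(** Otherwise both Cauchy data at 1 would vanish. *)
Lemma null_vector_slope F F1 lam u w w1 w2 : C1_jet F F1 -> (forall x, continuous u x) ->
  null_vector F1 lam u w w1 w2 -> w1 1 <> 0.
Proof.
intros HF Hu W Hw; destruct (nv_nonzero W) as [x [Hx Hn]]; apply Hn.
destruct (bounded_on_segment (fun x => lam * F1 (u x)) (-1) 1) as [K [_ HK]]; [lra| |].
{ intros z; apply (continuous_scal_r (V := R_NormedModule) lam (fun x => F1 (u x))).
  apply (continuous_comp u F1); [apply Hu|apply HF]. }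
apply (cauchy_unique w w1 w2 (fun x => lam * F1 (u x)) K x 1 (nv_jet W)).
- lra.
- intros z Hz; apply (nv_eq W); lra.
- intros z Hz; apply HK; lra.
- exact (nv_right W).
- exact Hw.
Qed.

Lemma solution_third_derivative F F1 g g1 lam mu u u1 u2 x : C1_jet F F1 ->
  even_forcing g g1 -> classical_solution F g lam mu u u1 u2 -> -1 < x < 1 ->
  is_derive u2 x (mu * g1 x - lam * (F1 (u x) * u1 x)).
Proof.
intros HF G S Hx.
apply (is_derive_ext_loc (fun x => mu * g x - lam * F (u x))).
- generalize (segment_locally (-1) 1 x Hx); apply filter_imp; intros y Hy.
  symmetry; exact (cs_eq S y Hy).
- assert (D1 := ef_der G x Hx).
  assert (D2 := proj1 HF (u x)).
  assert (D3 := proj1 (cs_jet S) x).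
  auto_derive.
  + repeat split; [exists (g1 x)|exists (F1 (u x))|exists (u1 x)]; assumption.
  + rewrite (Derive_of _ _ _ D1), (Derive_of _ _ _ D2), (Derive_of _ _ _ D3); ring.
Qed.

(** Both w and u' satisfy the linearised equation, u' with the source mu g', so
    their Wronskian w' u' - w u'' has derivative - mu g' w. Past the last zero
    [xi] of w it would have to decrease from a value at most 0 to a positive one. *)
Lemma no_last_zero F F1 g g1 lam mu u u1 u2 w w1 w2 xi : C1_jet F F1 -> even_forcing g g1 ->
  0 < lam -> 0 < mu -> classical_solution F g lam mu u u1 u2 -> u1 1 < 0 ->
  null_vector F1 lam u w w1 w2 -> 0 <= xi < 1 -> w xi = 0 ->
  (forall x, xi < x < 1 -> 0 < w x) -> False.
Proof.
intros HF G Hlam Hmu S Hu1 W Hxi Hw0 Hpos.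
assert (J := nv_jet W); assert (JU := cs_jet S).
assert (w1 1 <> 0) by (apply (null_vector_slope F F1 lam u w w1 w2 HF); [|exact W];
  intros x; exact (jet_cont _ _ _ x JU)).
assert (w1 1 <= 0).
{ apply (right_end_slope w w1 xi 1 (proj2 Hxi) (proj1 J) (jet_cont1 _ _ _ _ J)).
  intros x Hx; rewrite (nv_right W); left; exact (Hpos x Hx). }
assert (0 <= w1 xi).
{ apply (left_end_slope w w1 xi 1 (proj2 Hxi) (proj1 J) (jet_cont1 _ _ _ _ J)).
  intros x Hx; rewrite Hw0; left; exact (Hpos x Hx). }
assert (u1 xi <= 0).
{ apply (solution_nonincreasing F F1 g g1 lam mu u u1 u2 HF G Hlam Hmu S Hu1); lra. }
assert (Hdec : - (w1 xi * u1 xi - w xi * u2 xi) <= - (w1 1 * u1 1 - w 1 * u2 1)).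
{ apply (le_of_derive_ge0 (fun x => - (w1 x * u1 x - w x * u2 x))
           (fun x => mu * g1 x * w x)); [lra| | |].
  - intros x Hx.
    assert (D1 := proj1 (proj2 J) x); assert (D2 := proj1 (proj2 JU) x).
    assert (D3 := proj1 J x).
    assert (D4 := solution_third_derivative F F1 g g1 lam mu u u1 u2 x HF G S ltac:(lra)).
    auto_derive.
    + repeat split; eexists; first [exact D1|exact D2|exact D3|exact D4].
    + rewrite (Derive_of _ _ _ D1), (Derive_of _ _ _ D2), (Derive_of _ _ _ D3),
        (Derive_of _ _ _ D4), (nv_eq W) by lra; ring.
  - intros x _; apply (continuous_opp (fun x => w1 x * u1 x - w x * u2 x)).
    apply (continuous_minus (fun x => w1 x * u1 x) (fun x => w x * u2 x)).
    + apply (continuous_mult w1 u1); [exact (jet_cont1 _ _ _ _ J)|exact (jet_cont1 _ _ _ _ JU)].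
    + apply (continuous_mult w u2); [exact (jet_cont _ _ _ _ J)|apply JU].
  - intros x Hx; assert (H3 := ef_sign G x ltac:(lra)).
    assert (0 <= g1 x) by nra.
    apply Rmult_le_pos; [apply Rmult_le_pos; lra|left; exact (Hpos x Hx)]. }
rewrite Hw0, (nv_right W) in Hdec; nra.
Qed.

Lemma null_vector_nonzero_right F F1 g g1 lam mu u u1 u2 w w1 w2 x : C1_jet F F1 ->
  even_forcing g g1 -> 0 < lam -> 0 < mu -> classical_solution F g lam mu u u1 u2 ->
  u1 1 < 0 -> null_vector F1 lam u w w1 w2 -> 0 <= x < 1 -> w x <> 0.
Proof.
intros HF G Hlam Hmu S Hu1 W Hx Hw.
assert (J := nv_jet W).
destruct (completeness (fun z => 0 <= z < 1 /\ w z = 0)) as [xi [Hub Hlub]].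
{ exists 1; intros z Hz; lra. }
{ exists x; auto. }
assert (Hx' : x <= xi) by (apply Hub; auto).
assert (Hxi1 : xi <= 1) by (apply Hlub; intros z Hz; lra).
assert (Near : forall d, 0 < d -> exists z, 0 <= z < 1 /\ w z = 0 /\ xi - d < z <= xi).
{ intros d Hd; apply NNPP; intros Hn; assert (xi <= xi - d); [|lra].
  apply Hlub; intros z [Hz Hwz]; apply Rnot_lt_le; intros Hlt; apply Hn.
  exists z; repeat split; try lra; apply Hub; auto. }
assert (Hxi : xi < 1).
{ destruct (Rle_lt_or_eq_dec xi 1 Hxi1) as [ | ->]; [assumption|exfalso].
  destruct (nonzero_near w1 1 (jet_cont1 _ _ _ _ J)) as [d [Hd Hnz]].
  { apply (null_vector_slope F F1 lam u w w1 w2 HF); [|exact W].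
    intros z; exact (jet_cont _ _ _ z (cs_jet S)). }
  destruct (Near d Hd) as [z [Hz [Hwz Hzd]]].
  destruct (mean_value w w1 z 1 (proj2 Hz) (fun y _ => proj1 J y)
              (fun y _ => jet_cont _ _ _ y J)) as [c [Hc1 Hc2]].
  rewrite Hwz, (nv_right W) in Hc2.
  apply (Hnz c); [apply Rabs_def1; lra|nra]. }
assert (Hw0 : w xi = 0).
{ apply NNPP; intros Hn.
  destruct (nonzero_near w xi (jet_cont _ _ _ _ J) Hn) as [d [Hd Hnz]].
  destruct (Near d Hd) as [z [Hz [Hwz Hzd]]].
  apply (Hnz z); [apply Rabs_def1; lra|exact Hwz]. }
assert (Hnz : forall z, xi < z < 1 -> w z <> 0).
{ intros z Hz E; assert (z <= xi); [|lra]; apply Hub; split; [lra|exact E]. }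
set (m := (xi + 1) / 2); assert (Hm : xi < m < 1) by (unfold m; lra).
destruct (Rtotal_order (w m) 0) as [Hneg|[E|Hpos]]; [|exact (Hnz m Hm E)|].
- apply (no_last_zero F F1 g g1 lam mu u u1 u2 _ _ _ xi HF G Hlam Hmu S Hu1
           (null_vector_opp _ _ _ _ _ _ W)); [lra|lra|].
  apply (constant_sign (fun x => - w x) xi 1 m); [|exact Hm|lra|].
  + intros z; exact (jet_cont _ _ _ z (jet_opp _ _ _ J)).
  + intros z Hz; assert (H := Hnz z Hz); lra.
- apply (no_last_zero F F1 g g1 lam mu u u1 u2 _ _ _ xi HF G Hlam Hmu S Hu1 W); [lra|lra|].
  apply (constant_sign w xi 1 m); [|exact Hm|lra|exact Hnz].
  intros z; exact (jet_cont _ _ _ z J).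
Qed.

(** A null vector has one sign, since neither it nor its mirror image vanishes
    on [0,1). *)
Lemma positive_null_vector F F1 g g1 lam mu u u1 u2 w w1 w2 : C1_jet F F1 ->
  even_forcing g g1 -> 0 < lam -> 0 < mu -> classical_solution F g lam mu u u1 u2 ->
  u1 1 < 0 -> null_vector F1 lam u w w1 w2 ->
  exists p p1 p2, null_vector F1 lam u p p1 p2 /\ forall x, -1 < x < 1 -> 0 < p x.
Proof.
intros HF G Hlam Hmu S Hu1 W.
assert (Hnz : forall x, -1 < x < 1 -> w x <> 0).
{ intros x Hx; destruct (Rle_lt_dec 0 x) as [H0|H0].
  - apply (null_vector_nonzero_right F F1 g g1 lam mu u u1 u2 w w1 w2 x HF G Hlam Hmu S Hu1 W); lra.
  - assert (Hl := solution_slope_left F F1 g g1 lam mu u u1 u2 HF G Hlam Hmu S Hu1).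
    assert (Hr : - u1 (0 - 1) < 0) by (replace (0 - 1) with (-1) by ring; lra).
    assert (H := null_vector_nonzero_right F F1 g g1 lam mu _ _ _ _ _ _ (- x) HF G Hlam Hmu
             (solution_reflect F g g1 lam mu u u1 u2 G S) Hr
             (null_vector_reflect _ _ _ _ _ _ W) ltac:(lra)).
    cbv beta in H; replace (0 - - x) with x in H by ring; exact H. }
assert (J := nv_jet W).
destruct (Rtotal_order (w 0) 0) as [Hneg|[E|Hpos]].
- exists (fun x => - w x), (fun x => - w1 x), (fun x => - w2 x).
  split; [exact (null_vector_opp _ _ _ _ _ _ W)|].
  apply (constant_sign (fun x => - w x) (-1) 1 0); [|lra|lra|].
  + intros z; exact (jet_cont _ _ _ z (jet_opp _ _ _ J)).
  + intros z Hz; assert (H := Hnz z Hz); lra.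
- exfalso; apply (Hnz 0); [lra|exact E].
- exists w, w1, w2; split; [exact W|].
  apply (constant_sign w (-1) 1 0); [|lra|lra|exact Hnz].
  intros z; exact (jet_cont _ _ _ z J).
Qed.

(** * Direction of a turn *)

Definition taylor_rest (F F1 : R -> R) (a b : R) : R := F b - F a - F1 a * (b - a).

(** Concavity is asked only along the segment from [a] to [b], which in the application
    lies in the half-line, where [F] coincides with the given nonlinearity. *)
Lemma tangent_above F F1 a b : C1_jet F F1 ->
  (forall t, 0 < t < 1 -> t * F b + (1 - t) * F a <= F (t * b + (1 - t) * a)) ->
  taylor_rest F F1 a b <= 0.
Proof.
intros [Hd Hc] Hconc; unfold taylor_rest.
assert (0 <= F1 (0 * b + (1 - 0) * a) * (b - a) - (F b - F a)).
{ apply (left_end_slope (fun t => F (t * b + (1 - t) * a) - (t * F b + (1 - t) * F a))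
           (fun t => F1 (t * b + (1 - t) * a) * (b - a) - (F b - F a)) 0 1 Rlt_0_1).
  - intros t; assert (D := Hd (t * b + (1 + - t) * a)); auto_derive.
    + eexists; exact D.
    + rewrite (Derive_of _ _ _ D); unfold Rminus; ring.
  - apply (continuous_minus (fun t => F1 (t * b + (1 - t) * a) * (b - a)) (fun _ => F b - F a));
      [|apply continuous_const].
    apply (continuous_scal_l (V := R_NormedModule) (fun t => F1 (t * b + (1 - t) * a)) (b - a)).
    apply (continuous_comp (fun t => t * b + (1 - t) * a) F1); [|apply Hc].
    apply (is_derive_continuous _ _ (b - a)); auto_derive; [exact I|ring].
  - intros t Ht; assert (H := Hconc t Ht).
    replace (0 * b + (1 - 0) * a) with a by ring; lra. }
replace (0 * b + (1 - 0) * a) with a in H by ring; lra.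
Qed.

(** Green's identity between a null vector at [u] and the difference to another
    solution [U]; the nonlinearity enters only through its Taylor remainder. *)
Lemma green_derivative F F1 g lam0 mu0 lam mu u u1 u2 U U1 U2 w w1 w2 x :
  classical_solution F g lam0 mu0 u u1 u2 -> classical_solution F g lam mu U U1 U2 ->
  null_vector F1 lam0 u w w1 w2 -> -1 < x < 1 ->
  is_derive (fun x => w x * (U1 x - u1 x) - w1 x * (U x - u x)) x
    (w x * ((mu - mu0) * g x - lam * taylor_rest F F1 (u x) (U x)
            + (lam0 - lam) * (F (u x) + F1 (u x) * (U x - u x)))).
Proof.
intros S0 S W Hx.
assert (J0 := cs_jet S0); assert (J := cs_jet S).
assert (JW := nv_jet W).
assert (D1 := proj1 J0 x); assert (D2 := proj1 (proj2 J0) x).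
assert (D3 := proj1 J x); assert (D4 := proj1 (proj2 J) x).
assert (D5 := proj1 JW x); assert (D6 := proj1 (proj2 JW) x).
auto_derive.
- repeat split; eexists; first [exact D1|exact D2|exact D3|exact D4|exact D5|exact D6].
- rewrite (Derive_of _ _ _ D1), (Derive_of _ _ _ D2), (Derive_of _ _ _ D3),
    (Derive_of _ _ _ D4), (Derive_of _ _ _ D5), (Derive_of _ _ _ D6),
    (nv_eq W), (cs_eq S0), (cs_eq S) by exact Hx.
  unfold taylor_rest; ring.
Qed.

(** With [lam] fixed, the positive function g is the weight of mu - mu0 in Green's
    identity, and no smallness is needed. *)
Lemma no_solution_mu F F1 g g1 lam mu0 mu u u1 u2 U U1 U2 w w1 w2 :
  even_forcing g g1 -> 0 < lam ->
  classical_solution F g lam mu0 u u1 u2 -> classical_solution F g lam mu U U1 U2 ->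
  null_vector F1 lam u w w1 w2 -> (forall x, -1 < x < 1 -> 0 < w x) -> mu <> mu0 ->
  (forall x, -1 < x < 1 -> (mu - mu0) * taylor_rest F F1 (u x) (U x) <= 0) -> False.
Proof.
intros G Hlam S0 S W Hw Hne HR.
set (d := mu - mu0) in *; assert (Hd : d <> 0) by (unfold d; lra).
assert (J0 := cs_jet S0); assert (J := cs_jet S).
assert (JW := nv_jet W).
assert (HN : d * (w (-1) * (U1 (-1) - u1 (-1)) - w1 (-1) * (U (-1) - u (-1)))
             < d * (w 1 * (U1 1 - u1 1) - w1 1 * (U 1 - u 1))).
{ apply (lt_of_derive_gt0 (fun x => d * (w x * (U1 x - u1 x) - w1 x * (U x - u x)))
    (fun x => d * (w x * (d * g x - lam * taylor_rest F F1 (u x) (U x)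
            + (lam - lam) * (F (u x) + F1 (u x) * (U x - u x)))))); [lra| | |].
  - intros x Hx.
    apply (is_derive_scal (fun x => w x * (U1 x - u1 x) - w1 x * (U x - u x)) x d).
    apply (green_derivative F F1 g lam mu0 lam mu u u1 u2 U U1 U2 w w1 w2 x S0 S W Hx).
  - intros x _.
    apply (continuous_scal_r (V := R_NormedModule) d
             (fun x => w x * (U1 x - u1 x) - w1 x * (U x - u x))).
    exact (jet_wronskian_continuous _ _ _ _ _ _ x JW (jet_minus _ _ _ _ _ _ J J0)).
  - intros x Hx; assert (H := HR x Hx).
    assert (Hg := forcing_pos g g1 x G Hx); assert (Hw' := Hw x Hx).
    set (r := taylor_rest F F1 (u x) (U x)) in *.
    replace (d * _) with (w x * (d * d * g x + lam * - (d * r))) by ring.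
    assert (0 < d * d) by (apply Rsqr_pos_lt in Hd; exact Hd).
    apply Rmult_lt_0_compat; [exact Hw'|].
    assert (0 < d * d * g x) by (apply Rmult_lt_0_compat; lra).
    assert (0 <= lam * - (d * r)) by (apply Rmult_le_pos; lra); lra. }
rewrite (nv_left W), (nv_right W), (cs_left S0),
  (cs_left S), (cs_right S0), (cs_right S) in HN.
lra.
Qed.

(** Pairing the null vector with x u', which solves the linearised equation with
    source mu x g' + 2 u'', produces the weight F(u). Integrated over [-1,1], this
    makes the integral of F(u) w positive. *)
Lemma pohozaev_derivative F F1 g g1 lam mu u u1 u2 w w1 w2 x : C1_jet F F1 ->
  even_forcing g g1 -> classical_solution F g lam mu u u1 u2 ->
  null_vector F1 lam u w w1 w2 -> -1 < x < 1 ->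
  is_derive (fun x => w x * (u1 x + x * u2 x) - w1 x * (x * u1 x)) x
    (w x * (2 * mu * g x - 2 * lam * F (u x) + mu * (x * g1 x))).
Proof.
intros HF G S W Hx.
assert (J := cs_jet S); assert (JW := nv_jet W).
assert (D2 := proj1 (proj2 J) x).
assert (D3 := solution_third_derivative F F1 g g1 lam mu u u1 u2 x HF G S Hx).
assert (D5 := proj1 JW x); assert (D6 := proj1 (proj2 JW) x).
auto_derive.
- repeat split; eexists; first [exact D2|exact D3|exact D5|exact D6].
- rewrite (Derive_of _ _ _ D2), (Derive_of _ _ _ D3),
    (Derive_of _ _ _ D5), (Derive_of _ _ _ D6),
    (nv_eq W), (cs_eq S) by exact Hx.
  ring.
Qed.

(** Write d = lam0 - lam. Green's identity weighs d by F(u) + F1(u) (U - u), whose sign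
    is unknown. A multiple of the identity of [pohozaev_derivative] trades F(u) for
    mu g / lam0, which dominates the small first order term, at the price of boundary
    terms w'(1) u'(1) and w'(-1) u'(-1) of a favourable sign. *)
Lemma no_solution_lam F F1 g g1 lam0 lam mu u u1 u2 U U1 U2 w w1 w2 :
  C1_jet F F1 -> even_forcing g g1 -> 0 < lam0 -> 0 < lam -> 0 < mu ->
  classical_solution F g lam0 mu u u1 u2 -> classical_solution F g lam mu U U1 U2 ->
  u1 1 < 0 ->
  null_vector F1 lam0 u w w1 w2 -> (forall x, -1 < x < 1 -> 0 < w x) -> lam <> lam0 ->
  (forall x, -1 < x < 1 -> lam0 * Rabs (F1 (u x) * (U x - u x)) <= mu * g 0) ->
  (forall x, -1 < x < 1 -> (lam0 - lam) * taylor_rest F F1 (u x) (U x) <= 0) -> False.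
Proof.
intros HF G Hlam0 Hlam Hmu S0 S Hu1 W Hw Hne Hsmall HR.
assert (Hu1' := solution_slope_left F F1 g g1 lam0 mu u u1 u2 HF G Hlam0 Hmu S0 Hu1).
set (d := lam0 - lam) in *; assert (Hd : d <> 0) by (unfold d; lra).
assert (Hdd : 0 < d * d) by (apply Rsqr_pos_lt in Hd; exact Hd).
assert (J0 := cs_jet S0); assert (J := cs_jet S).
assert (JW := nv_jet W).
set (N := fun x => w x * (U1 x - u1 x) - w1 x * (U x - u x)).
set (P := fun x => w x * (u1 x + x * u2 x) - w1 x * (x * u1 x)).
(* The factor d^2 / (2 lam0) is chosen so that the terms with F(u) cancel. *)
assert (HN : d * N (-1) + d * d / (2 * lam0) * P (-1) <= d * N 1 + d * d / (2 * lam0) * P 1).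
{ apply (le_of_derive_ge0 (fun x => d * N x + d * d / (2 * lam0) * P x)
    (fun x => d * (w x * ((mu - mu) * g x - lam * taylor_rest F F1 (u x) (U x)
            + d * (F (u x) + F1 (u x) * (U x - u x))))
        + d * d / (2 * lam0) * (w x * (2 * mu * g x - 2 * lam0 * F (u x) + mu * (x * g1 x)))));
    [lra| | |].
  - intros x Hx.
    apply (is_derive_plus (fun x => d * N x) (fun x => d * d / (2 * lam0) * P x)).
    + apply (is_derive_scal N x d).
      apply (green_derivative F F1 g lam0 mu lam mu u u1 u2 U U1 U2 w w1 w2 x S0 S W Hx).
    + apply (is_derive_scal P x (d * d / (2 * lam0))).
      exact (pohozaev_derivative F F1 g g1 lam0 mu u u1 u2 w w1 w2 x HF G S0 W Hx).
  - intros x _.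
    apply (continuous_plus (fun x => d * N x) (fun x => d * d / (2 * lam0) * P x)).
    + apply (continuous_scal_r (V := R_NormedModule) d N).
      exact (jet_wronskian_continuous _ _ _ _ _ _ x JW (jet_minus _ _ _ _ _ _ J J0)).
    + apply (continuous_scal_r (V := R_NormedModule) (d * d / (2 * lam0)) P).
      apply (continuous_minus (fun x => w x * (u1 x + x * u2 x)) (fun x => w1 x * (x * u1 x))).
      * apply (continuous_mult w (fun x => u1 x + x * u2 x)); [exact (jet_cont _ _ _ _ JW)|].
        apply (continuous_plus u1 (fun x => x * u2 x)); [exact (jet_cont1 _ _ _ _ J0)|].
        apply (continuous_mult (fun x => x) u2); [apply continuous_id|exact (jet_cont2 _ _ _ _ J0)].
      * apply (continuous_mult w1 (fun x => x * u1 x)); [exact (jet_cont1 _ _ _ _ JW)|].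
        apply (continuous_mult (fun x => x) u1); [apply continuous_id|exact (jet_cont1 _ _ _ _ J0)].
  - intros x Hx; assert (H := HR x Hx); assert (Hs := Hsmall x Hx).
    assert (Hg0 : g 0 <= g x).
    { apply (forcing_mono g g1 _ _ G); [rewrite Rabs_R0; apply Rabs_pos|apply Rabs_def1; lra]. }
    assert (Hg1 := ef_sign G x Hx); assert (Hw' := Hw x Hx).
    set (r := taylor_rest F F1 (u x) (U x)) in *.
    set (e := F1 (u x) * (U x - u x)) in *.
    replace (_ + _) with (w x * (lam * - (d * r)
      + d * d / lam0 * ((mu * g x + lam0 * e) + mu * (x * g1 x) / 2)))
      by (field; lra).
    assert (He := Rle_abs (- e)); rewrite Rabs_Ropp in He.
    assert (mu * g 0 <= mu * g x) by (apply Rmult_le_compat_l; lra).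
    assert (lam0 * - e <= lam0 * Rabs e) by (apply Rmult_le_compat_l; lra).
    assert (0 <= mu * (x * g1 x)) by (apply Rmult_le_pos; lra).
    apply Rmult_le_pos; [lra|]; apply Rplus_le_le_0_compat; apply Rmult_le_pos; try lra.
    left; apply Rdiv_lt_0_compat; lra. }
unfold N, P in HN.
rewrite (nv_left W), (nv_right W), (cs_left S0),
  (cs_left S), (cs_right S0), (cs_right S) in HN.
assert (Hc : 0 < d * d / (2 * lam0)) by (apply Rdiv_lt_0_compat; lra).
assert (A1 : w1 1 <= 0).
{ apply (right_end_slope w w1 (-1) 1 ltac:(lra) (proj1 JW) (jet_cont1 _ _ _ _ JW)).
  intros x Hx; rewrite (nv_right W); left; exact (Hw x Hx). }
assert (A2 : 0 <= w1 (-1)).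
{ apply (left_end_slope w w1 (-1) 1 ltac:(lra) (proj1 JW) (jet_cont1 _ _ _ _ JW)).
  intros x Hx; rewrite (nv_left W); left; exact (Hw x Hx). }
assert (A3 : w1 1 <> 0) by (apply (null_vector_slope F F1 lam0 u w w1 w2 HF); [|exact W];
  intros x; exact (jet_cont _ _ _ x J0)).
assert (A4 : 0 < w1 1 * u1 1) by nra.
assert (A5 : 0 <= w1 (-1) * u1 (-1)) by nra.
assert (0 < d * d / (2 * lam0) * (w1 1 * u1 1 + w1 (-1) * u1 (-1)))
  by (apply Rmult_lt_0_compat; lra).
lra.
Qed.

(** * Extension to the whole line *)

Lemma is_derive_on_interior (D : R -> Prop) f x l : locally x D ->
  is_derive_on D f x l -> is_derive f x l.
Proof.
intros HD [Hl H]; split; [exact Hl|].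
intros y Hy; rewrite <- (is_filter_lim_locally_unique _ _ Hy).
intros eps; generalize (filter_and _ _ HD (H x (within_lim D x) eps)).
apply filter_imp; intros z [Hz Hz']; exact (Hz' Hz).
Qed.

Lemma continuous_retract (D : R -> Prop) (r h : R -> R) x :
  (forall y, D (r y)) -> (forall y z, Rabs (r z - r y) <= Rabs (z - y)) ->
  continuous_on D h -> continuous (fun y => h (r y)) x.
Proof.
intros HD Hr Hh.
apply (filterlim_comp _ _ _ r h _ (within D (locally (r x)))); [|apply Hh, HD].
intros P [d Hd]; exists d; intros y Hy; apply Hd; [|apply HD].
eapply Rle_lt_trans; [apply Hr|exact Hy].
Qed.

(** The extension is the primitive of [df]; the retraction [r] gives the mean value
    theorem a function that is continuous up to the boundary of [D]. *)
Lemma derivative_extension (D : R -> Prop) (r f df : R -> R) x0 :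
  (forall x, D (r x)) -> (forall x, D x -> r x = x) ->
  (forall x y, Rabs (r y - r x) <= Rabs (y - x)) ->
  (forall x y z, D x -> D y -> x <= z <= y -> D z) -> D x0 ->
  continuous_on D f -> (forall x, continuous df x) ->
  (forall x, D x -> is_derive_on D f x (df x)) ->
  exists F, (forall x, is_derive F x (df x)) /\ forall x, D x -> F x = f x.
Proof.
intros HD Hid Hr Hconv H0 Hf Hdf Hd.
set (F := fun x => f x0 + RInt df x0 x).
assert (DF : forall x, is_derive F x (df x)).
{ intros x; unfold F; replace (df x) with (0 + df x) by ring.
  apply (is_derive_plus (fun _ => f x0) (fun x => RInt df x0 x)).
  - apply (is_derive_const (V := R_NormedModule)).
  - apply (is_derive_RInt df _ x0); [|apply Hdf].
    apply filter_forall; intros y; apply (RInt_correct df).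
    apply (ex_RInt_continuous (V := R_CompleteNormedModule)); intros z _; apply Hdf. }
assert (F0 : F x0 = f x0) by (unfold F; rewrite RInt_point; apply Rplus_0_r).
exists F; split; [exact DF|].
assert (Dd : forall a b z, D a -> D b -> a < z < b -> is_derive (fun x => F x - f (r x)) z 0).
{ intros a b z Ha Hb Hz.
  assert (Hloc : locally z D).
  { generalize (segment_locally a b z Hz); apply filter_imp; intros y Hy.
    apply (Hconv a b); [exact Ha|exact Hb|lra]. }
  replace 0 with (df z - df z) by ring.
  apply (is_derive_minus F (fun x => f (r x))); [apply DF|].
  apply (is_derive_ext_loc f).
  - revert Hloc; apply filter_imp; intros y Hy; rewrite Hid by exact Hy; reflexivity.
  - apply (is_derive_on_interior D); [exact Hloc|].
    apply Hd; apply (Hconv a b); [exact Ha|exact Hb|lra]. }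
assert (Cd : forall z, continuous (fun x => F x - f (r x)) z).
{ intros z; apply (continuous_minus F (fun x => f (r x))).
  - exact (is_derive_continuous _ _ _ (DF z)).
  - exact (continuous_retract D r f z HD Hr Hf). }
assert (E : forall a b, D a -> D b -> a < b -> F b - f b = F a - f a).
{ intros a b Ha Hb Hab.
  destruct (mean_value (fun x => F x - f (r x)) (fun _ => 0) a b Hab
              (fun z Hz => Dd a b z Ha Hb Hz) (fun z _ => Cd z)) as [c [_ Hc]].
  rewrite (Hid a Ha), (Hid b Hb) in Hc; lra. }
intros x Hx; destruct (Rtotal_order x x0) as [H|[->|H]].
- assert (H' := E x x0 Hx H0 H); lra.
- exact F0.
- assert (H' := E x0 x H0 Hx H); lra.
Qed.

Lemma C1_halfline_extension f : Ck_on 1 halfline f ->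
  exists F F1, C1_jet F F1 /\ forall y, 0 <= y -> F y = f y.
Proof.
intros Hf.
assert (HD : forall x, halfline (Rmax 0 x)) by (intros x; apply Rmax_l).
assert (Hid : forall x, halfline x -> Rmax 0 x = x) by (intros x; apply Rmax_right).
assert (Hr : forall x y, Rabs (Rmax 0 y - Rmax 0 x) <= Rabs (y - x)).
{ intros x y; unfold Rmax; repeat destruct Rle_dec; unfold Rabs; repeat destruct Rcase_abs; lra. }
assert (Hdense : dense_in_itself halfline).
{ intros x e Hx; assert (He := cond_pos e); unfold halfline in *; exists (x + e / 2).
  repeat split; try lra; rewrite Rabs_pos_eq; lra. }
set (F1 := fun y => derive_on halfline f (Rmax 0 y)).
assert (HF1 : forall x, continuous F1 x).
{ intros x; apply (continuous_retract halfline (Rmax 0) (derive_on halfline f) x HD Hr).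
  exact (proj2 Hf). }
destruct (derivative_extension halfline (Rmax 0) f F1 0) as [F [DF EF]]; auto.
- unfold halfline; intros; lra.
- unfold halfline; lra.
- exact (Ck_on_continuous halfline 1 Hdense f Hf).
- intros x Hx; unfold F1; rewrite Hid by exact Hx.
  apply derive_on_correct; [exact Hdense|exact Hx|exact (proj1 Hf x Hx)].
- exists F, F1; split; [split; [exact DF|exact HF1]|exact EF].
Qed.

Definition jet_extends (u : C2) (U U1 U2 : R -> R) : Prop :=
  C2_jet U U1 U2 /\ forall x, ccint x ->
    U x = u x /\ U1 x = derive_on ccint u x /\ U2 x = derive_on ccint (derive_on ccint u) x.

Lemma C2_extension (u : C2) : exists U U1 U2, jet_extends u U U1 U2.
Proof.
destruct (C2_cont u) as [C0 [C1 C2']]; assert (Hu := C2_reg u).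
assert (Hconv : forall x y z, ccint x -> ccint y -> x <= z <= y -> ccint z)
  by (unfold ccint; intros; lra).
assert (H0 : ccint 0) by (unfold ccint; lra).
set (U2 := fun x => derive_on ccint (derive_on ccint u) (clamp x)).
assert (HU2 : forall x, continuous U2 x).
{ intros x; apply (continuous_retract ccint clamp _ x clamp_in clamp_lip C2'). }
destruct (derivative_extension ccint clamp (derive_on ccint u) U2 0 clamp_in clamp_id
            clamp_lip Hconv H0 C1 HU2) as [U1 [D1 E1]].
{ intros x Hx; unfold U2; rewrite clamp_id by exact Hx.
  apply derive_on_correct; [exact dense_ccint|exact Hx|exact (proj1 (proj2 Hu) x Hx)]. }
destruct (derivative_extension ccint clamp u U1 0 clamp_in clamp_id
            clamp_lip Hconv H0 C0 (fun x => is_derive_continuous _ _ _ (D1 x))) as [U [D0 E0]].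
{ intros x Hx; rewrite E1 by exact Hx.
  apply derive_on_correct; [exact dense_ccint|exact Hx|exact (proj1 Hu x Hx)]. }
exists U, U1, U2; split; [split; [exact D0|split; [exact D1|exact HU2]]|].
intros x Hx; split; [|split]; auto.
unfold U2; rewrite clamp_id by exact Hx; reflexivity.
Qed.

Lemma classical_of_positive f F g lam mu (u : C2) U U1 U2 :
  (forall y, 0 <= y -> F y = f y) -> jet_extends u U U1 U2 ->
  positive_solution f g lam mu u -> classical_solution F g lam mu U U1 U2.
Proof.
intros HF [J E] [_ _ Eq L R P].
assert (I1 : ccint (-1)) by (unfold ccint; lra); assert (I2 : ccint 1) by (unfold ccint; lra).
assert (Io : forall x, -1 < x < 1 -> ccint x) by (unfold ccint; intros; lra).
split.
- exact J.
- intros x Hx; assert (H := Eq x Hx).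
  rewrite (Derive_n_ext_loc u U) in H.
  + assert (H2 : Derive_n U 2 x = U2 x).
    { simpl; rewrite (Derive_ext (Derive (fun x => U x)) U1).
      - apply is_derive_unique, J.
      - intros t; apply is_derive_unique, J. }
    rewrite H2 in H; rewrite HF; rewrite (proj1 (E x (Io x Hx))); [lra|].
    left; exact (P x Hx).
  + generalize (segment_locally (-1) 1 x Hx); apply filter_imp; intros y Hy.
    symmetry; exact (proj1 (E y (Io y Hy))).
- rewrite (proj1 (E _ I1)); exact L.
- rewrite (proj1 (E _ I2)); exact R.
- intros x Hx; rewrite (proj1 (E x (Io x Hx))); exact (P x Hx).
Qed.

(** * Tangents to solution curves *)

Lemma is_derive_linear {V W : NormedModule R_AbsRing} (h : R -> V) (l : V -> W) s d :
  is_linear l -> is_derive h s d -> is_derive (fun t => l (h t)) s (l d).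
Proof.
intros Hl Hd.
apply (filterdiff_ext_lin _ (fun y : R => l (scal y d))).
- apply (filterdiff_comp' h l s (fun y : R => scal y d) l Hd).
  apply filterdiff_linear, Hl.
- intros y; apply (linear_scal l Hl).
Qed.

Lemma is_linear_eval x : ccint x ->
  is_linear (fun u : C2_NormedModule => (u : C2) x : R_NormedModule).
Proof.
intros Hx; split.
- intros u v; simpl; unfold plus; simpl; ring.
- intros k u; simpl; unfold scal; simpl; unfold mult; simpl; ring.
- exists 1; split; [lra|]; intros u; rewrite Rmult_1_l; exact (C2_norm_ge u x Hx).
Qed.

Lemma is_linear_eval2 x : ccint x -> is_linear (fun u : C2_NormedModule =>
  derive_on ccint (derive_on ccint (u : C2)) x : R_NormedModule).
Proof.
intros Hx; split.
- intros u v.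
  change (derive_on ccint (derive_on ccint (C2_lin 1 1 u v)) x
    = derive_on ccint (derive_on ccint u) x + derive_on ccint (derive_on ccint v) x).
  rewrite C2_lin_derive2 by exact Hx; ring.
- intros k u.
  change (derive_on ccint (derive_on ccint (C2_lin k 0 u u)) x
    = k * derive_on ccint (derive_on ccint u) x).
  rewrite C2_lin_derive2 by exact Hx; ring.
- exists 1; split; [lra|]; intros u; rewrite Rmult_1_l.
  change (Rabs (derive_on ccint (derive_on ccint (u : C2)) x) <= C2_norm u).
  destruct (C2_cont u) as [H0 [H1 H2]]; unfold C2_norm.
  assert (A0 := sup_abs_ub _ x H0 Hx); assert (P0 := Rabs_pos ((u : C2) x)).
  assert (A1 := sup_abs_ub _ x H1 Hx); assert (P1 := Rabs_pos (derive_on ccint (u : C2) x)).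
  assert (A2 := sup_abs_ub _ x H2 Hx); lra.
Qed.

Lemma C2_nonzero (u : C2) : u <> C2_zero -> exists x, ccint x /\ u x <> 0.
Proof.
intros Hn; apply NNPP; intros H; apply Hn, C2_eq; intros x; simpl.
destruct (classic (ccint x)) as [Hx|Hx]; [|exact (C2_off u x Hx)].
apply NNPP; intros Hne; apply H; exists x; auto.
Qed.

Lemma equation_derivative F F1 (g l m h : R -> R) (x s0 y d : R) : C1_jet F F1 ->
  is_derive l s0 0 -> is_derive m s0 0 -> is_derive h s0 d -> h s0 = y ->
  is_derive (fun s : R => m s * g x - l s * F (h s)) s0 (- (l s0 * F1 y) * d).
Proof.
intros HF Hl Hm Hh <-; assert (DF := proj1 HF (h s0)); auto_derive.
- repeat split; eexists; first [exact Hm|exact Hl|exact DF|exact Hh].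
- rewrite (Derive_of _ _ _ Hm), (Derive_of _ _ _ Hl), (Derive_of _ _ _ DF),
    (Derive_of _ _ _ Hh); ring.
Qed.

(** Differentiating the equation along a curve on which both parameters are
    stationary. *)
Lemma stationary_null_vector f F F1 g (l m : R -> R) (U : R -> C2_NormedModule)
  (W : C2_NormedModule) s0 u u1 u2 :
  C1_jet F F1 -> (forall y, 0 <= y -> F y = f y) ->
  locally s0 (fun s => positive_solution f g (l s) (m s) (U s : C2)) ->
  is_derive l s0 0 -> is_derive m s0 0 -> is_derive U s0 W -> W <> zero ->
  jet_extends (U s0) u u1 u2 ->
  exists w w1 w2, null_vector F1 (l s0) u w w1 w2.
Proof.
intros HF Hf Hsol Hl Hm HU HW [Ju Eu].
destruct (C2_extension W) as [w [w1 [w2 [Jw Ew]]]].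
exists w, w1, w2.
assert (Dev : forall x, ccint x -> is_derive (fun s => (U s : C2) x) s0 (w x)).
{ intros x Hx; rewrite (proj1 (Ew x Hx)).
  exact (is_derive_linear U _ s0 W (is_linear_eval x Hx) HU). }
assert (Hend : forall x, ccint x -> locally s0 (fun s => (U s : C2) x = 0) -> w x = 0).
{ intros x Hx H0.
  assert (D0 : is_derive (fun _ : R => 0) s0 (w x)).
  { apply (is_derive_ext_loc (fun s => (U s : C2) x)); [exact H0|exact (Dev x Hx)]. }
  rewrite <- (is_derive_unique _ _ _ D0); apply Derive_const. }
split.
- exact Jw.
- intros x Hx; assert (Hx' : ccint x) by (unfold ccint; lra).
  assert (D2 : is_derive (fun s => derive_on ccint (derive_on ccint (U s : C2)) x) s0 (w2 x)).
  { rewrite (proj2 (proj2 (Ew x Hx'))).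
    exact (is_derive_linear U _ s0 W (is_linear_eval2 x Hx') HU). }
  assert (D3 : is_derive (fun s => m s * g x - l s * F ((U s : C2) x)) s0
                 (- (l s0 * F1 (u x)) * w x)).
  { exact (equation_derivative F F1 g l m (fun s => (U s : C2) x) x s0 (u x) (w x)
             HF Hl Hm (Dev x Hx') (eq_sym (proj1 (Eu x Hx')))). }
  rewrite <- (is_derive_unique _ _ _ D2), <- (is_derive_unique _ _ _ D3).
  apply Derive_ext_loc; revert Hsol; apply filter_imp; intros s Hs.
  destruct (C2_extension (U s)) as [v [v1 [v2 Hv]]].
  assert (Scl := classical_of_positive f F g _ _ _ v v1 v2 Hf Hv Hs).
  destruct Hv as [_ Ev]; destruct (Ev x Hx') as [E0 [_ E2]].
  rewrite <- E2, <- E0; exact (cs_eq Scl x Hx).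
- apply Hend; [unfold ccint; lra|].
  revert Hsol; apply filter_imp; intros s Hs; exact (ps_left _ _ _ _ _ Hs).
- apply Hend; [unfold ccint; lra|].
  revert Hsol; apply filter_imp; intros s Hs; exact (ps_right _ _ _ _ _ Hs).
- destruct (C2_nonzero W) as [x [Hx Hn]]; [exact HW|].
  exists x; split; [exact Hx|rewrite (proj1 (Ew x Hx)); exact Hn].
Qed.

Lemma turn_stationary p s0 l : turns p s0 -> is_derive p s0 l -> l = 0.
Proof.
intros Ht Hd; apply is_derive_Reals in Hd.
set (pr := exist _ l Hd : derivable_pt p s0).
assert (E : derive_pt p s0 pr = l) by reflexivity.
rewrite <- E; destruct Ht as [[d H]|[d H]]; assert (Hp := cond_pos d).
- apply (deriv_minimum p (s0 - d) (s0 + d)); try lra.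
  intros x H1 H2; destruct (Req_dec x s0) as [->|Hx]; [lra|].
  left; apply H; [apply Rabs_def1; simpl; unfold minus, plus, opp; simpl; lra|exact Hx].
- apply (deriv_maximum p (s0 - d) (s0 + d)); try lra.
  intros x H1 H2; destruct (Req_dec x s0) as [->|Hx]; [lra|].
  left; apply H; [apply Rabs_def1; simpl; unfold minus, plus, opp; simpl; lra|exact Hx].
Qed.

Lemma locally_meets (P Q : R -> Prop) s0 : locally s0 P -> locally' s0 Q ->
  exists s, P s /\ Q s.
Proof.
intros HP HQ; destruct (filter_and _ _ HP HQ) as [d Hd].
assert (Hp := cond_pos d).
destruct (Hd (s0 + d / 2)) as [H1 H2].
- apply Rabs_def1; simpl; unfold minus, plus, opp; simpl; lra.
- exists (s0 + d / 2); split; [exact H1|apply H2; lra].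
Qed.

Lemma only_right_turns_of a b p :
  (forall s0 : R, Rbar_lt a s0 -> Rbar_lt s0 b -> turns p s0 ->
     locally s0 (fun s => ~ p s < p s0)) -> only_right_turns a b p.
Proof.
intros H s0 Ha Hb Ht; assert (Hl := H s0 Ha Hb Ht); destruct Ht as [Hmin|Hmax]; [exact Hmin|].
destruct (locally_meets _ _ s0 Hl Hmax) as [s [H1 H2]]; contradiction.
Qed.

Lemma only_left_turns_of a b p :
  (forall s0 : R, Rbar_lt a s0 -> Rbar_lt s0 b -> turns p s0 ->
     locally s0 (fun s => ~ p s0 < p s)) -> only_left_turns a b p.
Proof.
intros H s0 Ha Hb Ht; assert (Hl := H s0 Ha Hb Ht); destruct Ht as [Hmin|Hmax]; [|exact Hmax].
destruct (locally_meets _ _ s0 Hl Hmin) as [s [H1 H2]]; contradiction.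
Qed.

Lemma locally_between (a b : Rbar) (s0 : R) : Rbar_lt a s0 -> Rbar_lt s0 b ->
  locally s0 (fun s : R => Rbar_lt a s /\ Rbar_lt s b).
Proof.
intros Ha Hb; apply filter_and.
- exact (open_Rbar_gt' s0 a Ha).
- exact (open_Rbar_lt' s0 b Hb).
Qed.

(** At a turn the parameter is stationary, so regularity of the curve leaves a
    nonzero tangent in the state space. *)
Lemma turn_tangent sol a b c (s0 : R) : curve_of_solutions sol a b c ->
  Rbar_lt a s0 -> Rbar_lt s0 b -> turns (param c) s0 ->
  is_derive (param c) s0 0 /\
  exists W : C2_NormedModule, is_derive (state c : R -> C2_NormedModule) s0 W /\ W <> zero.
Proof.
intros [[dc Hdc] _] Ha Hb Ht; destruct (Hdc s0 Ha Hb) as [Hd [_ Hn]].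
assert (H1 : is_derive (param c) s0 (fst (dc s0))).
{ exact (is_derive_linear c _ s0 (dc s0)
           (is_linear_fst (U := R_NormedModule) (V := C2_NormedModule)) Hd). }
assert (H2 : is_derive (state c : R -> C2_NormedModule) s0 (snd (dc s0))).
{ exact (is_derive_linear c _ s0 (dc s0)
           (is_linear_snd (U := R_NormedModule) (V := C2_NormedModule)) Hd). }
assert (E := turn_stationary _ _ _ Ht H1).
split; [rewrite <- E; exact H1|].
exists (snd (dc s0)); split; [exact H2|]; intros H0; apply Hn.
destruct (dc s0) as [d1 d2]; simpl in E, H0; rewrite E, H0; reflexivity.
Qed.

Lemma state_close (U : R -> C2_NormedModule) (W : C2_NormedModule) s0 e : is_derive U s0 W ->
  0 < e -> locally s0 (fun s => forall x, ccint x -> Rabs ((U s : C2) x - (U s0 : C2) x) <= e).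
Proof.
intros HU He.
assert (HC : continuous U s0) by (apply ex_derive_continuous; exists W; exact HU).
assert (H : locally s0 (fun s => ball (U s0) e (U s)))
  by exact (HC _ (locally_ball (U s0) (mkposreal e He))).
revert H; apply filter_imp; intros s Hs x Hx.
left; eapply Rle_lt_trans; [|exact Hs].
eapply Rle_trans; [|apply (C2_norm_ge _ x Hx)].
right; f_equal; simpl; ring.
Qed.

(** Everything that the two kinds of curves have in common at a turn; one of [l] and
    [m] will be constant. *)
Lemma turn_positive_null_vector f F F1 g g1 (l m : R -> R) (U : R -> C2_NormedModule)
  (W : C2_NormedModule) s0 :
  C1_jet F F1 -> (forall y, 0 <= y -> F y = f y) -> even_forcing g g1 ->
  locally s0 (fun s => 0 < l s /\ 0 < m s /\
    positive_solution f g (l s) (m s) (U s : C2) /\ derive_on ccint (U s : C2) 1 < 0) ->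
  is_derive l s0 0 -> is_derive m s0 0 -> is_derive U s0 W -> W <> zero ->
  exists u u1 u2 w w1 w2, jet_extends (U s0) u u1 u2 /\
    classical_solution F g (l s0) (m s0) u u1 u2 /\ u1 1 < 0 /\
    null_vector F1 (l s0) u w w1 w2 /\ forall x, -1 < x < 1 -> 0 < w x.
Proof.
intros HF Hf G Hsol Hl Hm HU HW.
destruct (locally_singleton _ _ Hsol) as [Hl0 [Hm0 [S0 Hu1]]].
destruct (C2_extension (U s0)) as [u [u1 [u2 Hu]]].
destruct (stationary_null_vector f F F1 g l m U W s0 u u1 u2 HF Hf)
  as [w0 [w01 [w02 W0]]]; try assumption.
{ revert Hsol; apply filter_imp; intros s Hs; apply Hs. }
assert (S := classical_of_positive f F g _ _ _ u u1 u2 Hf Hu S0).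
assert (Hu1' : u1 1 < 0).
{ rewrite (proj1 (proj2 (proj2 Hu 1 ltac:(unfold ccint; lra)))); exact Hu1. }
destruct (positive_null_vector F F1 g g1 _ _ u u1 u2 w0 w01 w02 HF G Hl0 Hm0 S Hu1' W0)
  as [w [w1 [w2 [Ww Hw]]]].
exists u, u1, u2, w, w1, w2; auto.
Qed.

(** The sign of the Taylor remainder of the nonlinearity decides on which side of its
    value at a turn the parameter can lie. *)
Lemma lambda_turn f F F1 g g1 mu a b c (s0 : R) :
  C1_jet F F1 -> (forall y, 0 <= y -> F y = f y) -> even_forcing g g1 -> 0 < mu ->
  solution_curve_lambda f g mu a b c ->
  Rbar_lt a s0 -> Rbar_lt s0 b -> turns (param c) s0 ->
  locally s0 (fun s => param c s <> param c s0 ->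
    ~ forall v w, 0 < v -> 0 < w ->
      (param c s0 - param c s) * taylor_rest F F1 v w <= 0).
Proof.
intros HF Hf G Hmu Hc Ha Hb Ht.
destruct (turn_tangent _ a b c s0 Hc Ha Hb Ht) as [Hp [W [HW HW0]]].
destruct Hc as [_ Hsol]; assert (Hl0 := proj1 (Hsol s0 Ha Hb)).
assert (Hab := locally_between a b s0 Ha Hb).
destruct (turn_positive_null_vector f F F1 g g1 (param c) (fun _ => mu) (state c) W s0)
  as [u [u1 [u2 [w [w1 [w2 [Hu [S0 [Hu1 [Ww Hw]]]]]]]]]]; try assumption.
{ revert Hab; apply filter_imp; intros s [H1 H2].
  destruct (Hsol s H1 H2) as [H3 [H4 H5]]; auto. }
{ apply (is_derive_const (V := R_NormedModule)). }
destruct (bounded_on_segment (fun x => F1 (u x)) (-1) 1) as [K [HK HKb]]; [lra| |].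
{ intros z; apply (continuous_comp u F1); [exact (jet_cont _ _ _ _ (proj1 Hu))|apply HF]. }
assert (Hg0 := ef_pos G).
(* Within distance [e] of u the first order term is dominated by mu g(0). *)
set (e := mu * g 0 / (param c s0 * (K + 1))).
assert (Hpk : 0 < param c s0 * (K + 1)) by (apply Rmult_lt_0_compat; lra).
assert (He : 0 < e) by (apply Rdiv_lt_0_compat; [apply Rmult_lt_0_compat; lra|exact Hpk]).
generalize (filter_and _ _ Hab (state_close (state c) W s0 e HW He)).
apply filter_imp; intros s [[Has Hbs] Hclose] Hne HR.
destruct (Hsol s Has Hbs) as [Hl [Ss _]].
destruct (C2_extension (state c s)) as [U [U1 [U2 HU]]].
assert (S := classical_of_positive f F g _ _ _ U U1 U2 Hf HU Ss).
apply (no_solution_lam F F1 g g1 (param c s0) (param c s) mu u u1 u2 U U1 U2 w w1 w2); auto.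
- intros x Hx; assert (Hx' : ccint x) by (unfold ccint; lra).
  assert (H := Hclose x Hx').
  rewrite <- (proj1 (proj2 HU x Hx')), <- (proj1 (proj2 Hu x Hx')) in H.
  rewrite Rabs_mult; assert (HK' := HKb x Hx').
  apply Rle_trans with (param c s0 * ((K + 1) * e)).
  + apply Rmult_le_compat_l; [lra|].
    apply Rmult_le_compat; try apply Rabs_pos; lra.
  + right; unfold e; field; lra.
- intros x Hx; apply HR;
    [exact (cs_pos S0 x Hx)|exact (cs_pos S x Hx)].
Qed.

Lemma mu_turn f F F1 g g1 lam a b c (s0 : R) :
  C1_jet F F1 -> (forall y, 0 <= y -> F y = f y) -> even_forcing g g1 -> 0 < lam ->
  solution_curve_mu f g lam a b c ->
  Rbar_lt a s0 -> Rbar_lt s0 b -> turns (param c) s0 ->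
  locally s0 (fun s => param c s <> param c s0 ->
    ~ forall v w, 0 < v -> 0 < w ->
      (param c s - param c s0) * taylor_rest F F1 v w <= 0).
Proof.
intros HF Hf G Hlam Hc Ha Hb Ht.
destruct (turn_tangent _ a b c s0 Hc Ha Hb Ht) as [Hp [W [HW HW0]]].
destruct Hc as [_ Hsol]; assert (Hab := locally_between a b s0 Ha Hb).
destruct (turn_positive_null_vector f F F1 g g1 (fun _ => lam) (param c) (state c) W s0)
  as [u [u1 [u2 [w [w1 [w2 [Hu [S0 [Hu1 [Ww Hw]]]]]]]]]]; try assumption.
{ revert Hab; apply filter_imp; intros s [H1 H2].
  destruct (Hsol s H1 H2) as [H3 [H4 H5]]; auto. }
{ apply (is_derive_const (V := R_NormedModule)). }
revert Hab; apply filter_imp; intros s [Has Hbs] Hne HR.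
destruct (Hsol s Has Hbs) as [_ [Ss _]].
destruct (C2_extension (state c s)) as [U [U1 [U2 HU]]].
assert (S := classical_of_positive f F g _ _ _ U U1 U2 Hf HU Ss).
apply (no_solution_mu F F1 g g1 lam (param c s0) (param c s) u u1 u2 U U1 U2 w w1 w2); auto.
intros x Hx; apply HR;
  [exact (cs_pos S0 x Hx)|exact (cs_pos S x Hx)].
Qed.

Theorem theorem2p2 (f g : R -> R)
  (f_C2 : Ck_on 2 halfline f)
  (g_C1 : Ck_on 1 ooint g)
  (g_C0 : continuous_on ccint g)
  (g_even : forall x, 0 < x < 1 -> g (- x) = g x)
  (g_0 : 0 < g 0)
  (g_mono : forall x, ooint x -> 0 <= x * Derive g x) :
  (concave_on halfline f ->
     (forall (mu : R) (a b : Rbar) (c : R -> RxC2), 0 < mu ->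
        solution_curve_lambda f g mu a b c -> only_right_turns a b (param c)) /\
     (forall (lam : R) (a b : Rbar) (c : R -> RxC2), 0 < lam ->
        solution_curve_mu f g lam a b c -> only_left_turns a b (param c)))
  /\
  (convex_on halfline f ->
     (forall (mu : R) (a b : Rbar) (c : R -> RxC2), 0 < mu ->
        solution_curve_lambda f g mu a b c -> only_left_turns a b (param c)) /\
     (forall (lam : R) (a b : Rbar) (c : R -> RxC2), 0 < lam ->
        solution_curve_mu f g lam a b c -> only_right_turns a b (param c))).
Proof.
assert (f_C1 : Ck_on 1 halfline f).
{ split; [exact (proj1 f_C2)|].
  intros x Hx; assert (PF := within_proper halfline x Hx).
  destruct (proj1 (proj2 f_C2) x Hx) as [l Hl].
  apply (filterdiff_continuous_aux (V := R_NormedModule) (derive_on halfline f));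
    [eexists; exact Hl|apply within_lim]. }
destruct (C1_halfline_extension f f_C1) as [F [F1 [HF Hf]]].
assert (G : even_forcing g (Derive g)).
{ split; [| |exact g_mono|exact g_0].
  - intros x Hx; destruct (proj1 g_C1 x Hx) as [l Hl].
    apply Derive_correct; exists l.
    apply (is_derive_on_interior ooint); [|exact Hl].
    exact (segment_locally (-1) 1 x Hx).
  - intros x Hx; destruct (Rtotal_order x 0) as [H|[ -> |H]].
    + rewrite <- (g_even (- x)) by lra; f_equal; ring.
    + f_equal; ring.
    + apply g_even; lra. }
split; intros Hconv.
- assert (HR : forall v w, 0 < v -> 0 < w -> taylor_rest F F1 v w <= 0).
  { intros v w Hv Hw; apply (tangent_above F F1 v w HF); intros t Ht.
    assert (0 <= t * w) by (apply Rmult_le_pos; lra).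
    assert (0 <= (1 - t) * v) by (apply Rmult_le_pos; lra).
    rewrite !Hf by lra; apply Hconv; unfold halfline; lra. }
  split.
  + intros mu a b c Hmu Hc; apply only_right_turns_of; intros s0 Ha Hb Ht.
    generalize (lambda_turn f F F1 g (Derive g) mu a b c s0 HF Hf G Hmu Hc Ha Hb Ht).
    apply filter_imp; intros s H Hlt; apply H; [lra|].
    intros v w Hv Hw; assert (HR' := HR v w Hv Hw); nra.
  + intros lam a b c Hlam Hc; apply only_left_turns_of; intros s0 Ha Hb Ht.
    generalize (mu_turn f F F1 g (Derive g) lam a b c s0 HF Hf G Hlam Hc Ha Hb Ht).
    apply filter_imp; intros s H Hlt; apply H; [lra|].
    intros v w Hv Hw; assert (HR' := HR v w Hv Hw); nra.
- assert (HR : forall v w, 0 < v -> 0 < w -> 0 <= taylor_rest F F1 v w).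
  { intros v w Hv Hw.
    assert (H : taylor_rest (fun y => - F y) (fun y => - F1 y) v w <= 0).
    { apply tangent_above.
      - split; intros y; [apply (is_derive_opp F), HF|apply (continuous_opp F1), HF].
      - intros t Ht.
        assert (0 <= t * w) by (apply Rmult_le_pos; lra).
        assert (0 <= (1 - t) * v) by (apply Rmult_le_pos; lra).
        rewrite !Hf by lra; assert (Hc := Hconv w v t); unfold halfline in Hc; lra. }
    unfold taylor_rest in *; lra. }
  split.
  + intros mu a b c Hmu Hc; apply only_left_turns_of; intros s0 Ha Hb Ht.
    generalize (lambda_turn f F F1 g (Derive g) mu a b c s0 HF Hf G Hmu Hc Ha Hb Ht).
    apply filter_imp; intros s H Hlt; apply H; [lra|].
    intros v w Hv Hw; assert (HR' := HR v w Hv Hw); nra.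
  + intros lam a b c Hlam Hc; apply only_right_turns_of; intros s0 Ha Hb Ht.
    generalize (mu_turn f F F1 g (Derive g) lam a b c s0 HF Hf G Hlam Hc Ha Hb Ht).
    apply filter_imp; intros s H Hlt; apply H; [lra|].
    intros v w Hv Hw; assert (HR' := HR v w Hv Hw); nra.
Qed.
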